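(* Let $d \geq 1$ and $n \geq 1$ be integers, and let $R$ be any one of the following commutative unital complex Banach algebras: the polydisc algebra $A(\overline{\mathbb{D}}^d)$, the ball algebra $A(\overline{\mathbb{B}_d})$, or the Wiener algebra $W^+(\overline{\mathbb{D}}^d)$. Then $SL_n(R) = E_n(R)$; that is, every $n\times n$ matrix with entries in $R$ and determinant $1$ is a finite product of elementary matrices over $R$.
   Context: For a commutative unital ring $R$, $SL_n(R)$ is the group of all $n\times n$ matrices with entries in $R$ and determinant $1$. An elementary matrix over $R$ is a matrix of the form $E_{ij}(\alpha) = I_n + \alpha\, \mathbf{e}_{ij}$, where $i \neq j$, $\alpha \in R$, $I_n$ is the $n\times n$ identity matrix, and $\mathbf{e}_{ij}$ is the $n \times n$ matrix whose entry in row $i$ and column $j$ is $1$ and whose other entries are $0$. $E_n(R)$ is the subgroup of $SL_n(R)$ generated by the elementary matrices. Let $\mathbb{D} = \{z \in \mathbb{C} : |z| < 1\}$, $\overline{\mathbb{D}} = \{z\in\mathbb{C} : |z| \leq 1\}$, $\mathbb{B}_d = \{(z_1,\dots,z_d) \in \mathbb{C}^d : |z_1|^2 + \cdots + |z_d|^2 < 1\}$ and $\overline{\mathbb{B}_d} = \{(z_1,\dots,z_d) \in \mathbb{C}^d : |z_1|^2 + \cdots + |z_d|^2 \leq 1\}$. The polydisc algebra $A(\overline{\mathbb{D}}^d)$ is the Banach algebra of all continuous functions $f : \overline{\mathbb{D}}^d \to \mathbb{C}$ that are holomorphic in $\mathbb{D}^d$, with pointwise operations and the supremum norm. The ball algebra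 $A(\overline{\mathbb{B}_d})$ is the Banach algebra of all continuous functions $f : \overline{\mathbb{B}_d} \to \mathbb{C}$ that are holomorphic in $\mathbb{B}_d$, with pointwise operations and the supremum norm. The Wiener algebra $W^+(\overline{\mathbb{D}}^d)$ is the Banach algebra of all functions on $\overline{\mathbb{D}}^d$ of the form $f(z_1,\dots,z_d) = \sum_{k_1=0}^\infty \cdots \sum_{k_d=0}^\infty a_{(k_1,\dots,k_d)} z_1^{k_1}\cdots z_d^{k_d}$ with complex coefficients satisfying $\|f\|_1 := \sum_{k_1=0}^\infty \cdots \sum_{k_d=0}^\infty |a_{(k_1,\dots,k_d)}| < \infty$, with pointwise addition and multiplication and norm $\|\cdot\|_1$. *)

(* Defs.v *)
From HB Require Import structures.
From mathcomp Require Import all_boot all_order all_algebra.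
From mathcomp Require Import complex.
From mathcomp Require Import all_classical all_reals all_analysis.

Set Implicit Arguments.
Unset Strict Implicit.
Unset Printing Implicit Defensive.

Import Order.TTheory GRing.Theory Num.Theory numFieldNormedType.Exports.

Local Open Scope classical_set_scope.
Local Open Scope ring_scope.

Section SpecialLinear.
Variables (A : comPzRingType) (n : nat).
Implicit Types M N : 'M[A]_n.

Definition special_linear : set 'M[A]_n := [set M | \det M = 1].

Definition elementary_mx (i j : 'I_n) (a : A) : 'M[A]_n :=
  1%:M + a *: delta_mx i j.

Definition elementary_mxs : set 'M[A]_n :=
  [set M | exists i j a, i != j /\ M = elementary_mx i j a].

(* Over a general commutative ring the library has no inverse on 'M[A]_n, so
   stability under inverses is expressed with an arbitrary inverse N of M. *)
Definition SL_subgroup (H : set 'M[A]_n) :=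
  [/\ H `<=` special_linear,
      H 1,
      forall M N, H M -> H N -> H (M * N)
    & forall M N, H M -> M * N = 1 -> N * M = 1 -> H N].

Definition elementary_group : set 'M[A]_n := smallest SL_subgroup elementary_mxs.

Lemma det_elementary_mx i j a : i != j -> \det (elementary_mx i j a) = 1.
Proof.
move=> ij; suff tr : forall (k l : 'I_n) (b : A), (k < l)%N -> \det (elementary_mx k l b) = 1.
  have [lt|gt|/val_inj e] := ltngtP i j; [exact: tr| |by rewrite e eqxx in ij].
  by rewrite -det_tr /elementary_mx raddfD /= tr_scalar_mx linearZ /= trmx_delta tr.
move=> k l b kl; rewrite -det_tr det_trig.
  rewrite big1// => m _; rewrite !mxE eqxx; case: (m =P k) => [->|_].
    by rewrite (_ : (k == l) = false) ?mulr0 ?addr0//; apply/ltn_eqF.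
  by rewrite mulr0 addr0.
apply/is_trig_mxP => p q pq; rewrite !mxE (_ : (q == p) = false) ?add0r; last first.
  exact/gtn_eqF.
case: (q =P k) => [e1|_]; last by rewrite mulr0.
case: (p =P l) => [e2|_]; last by rewrite mulr0.
by move: pq; rewrite e1 e2 ltnNge (ltnW kl).
Qed.

Lemma elementary_mxK i j a : i != j ->
  elementary_mx i j a * elementary_mx i j (- a) = 1.
Proof.
move=> ij; rewrite -mulmxE /elementary_mx mulmxDl mul1mx mulmxDr mulmx1 -scalemxAl -scalemxAr.
rewrite mul_delta_mx_0 1?eq_sym// !scaler0 addr0 -addrA -scalerDl addNr scale0r.
by rewrite addr0.
Qed.

Definition elementary_prod M :=
  exists2 s : seq 'M[A]_n, {in s, forall X, elementary_mxs X} &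
    M = \prod_(X <- s) X.

Lemma elementary_groupP M : elementary_group M <-> elementary_prod M.
Proof.
split=> [|[s sE ->] H [[_ H1 HM _] EH]]; last first.
  by rewrite big_seq; elim/big_ind: _ => // X /sE; exact: EH.
apply; split; last first.
  move=> X EX; exists [:: X]; last by rewrite big_seq1.
  by move=> Y; rewrite inE => /eqP ->.
split.
- move=> _ [s sE ->] /=; rewrite /special_linear /=.
  rewrite big_seq; elim/big_ind: _ => [|X Y dX dY|X /sE [i [j [a [ij ->]]]]].
  + by rewrite det1.
  + by rewrite det_mulmx dX dY mul1r.
  + exact: det_elementary_mx.
- by exists [::]; rewrite ?big_nil.
- move=> _ _ [s sE ->] [t tE ->]; exists (s ++ t); last by rewrite big_cat.
  by move=> X; rewrite mem_cat => /orP[/sE|/tE].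
- move=> _ N [s sE ->] _.
  elim: s sE N => [|X s IH] sE N.
    by rewrite big_nil mulr1 => ->; exists [::]; rewrite ?big_nil.
  rewrite big_cons mulrA => NXs.
  have [|t tE NX] := IH _ (N * X) NXs.
    by move=> Y Ys; apply: sE; rewrite inE Ys orbT.
  have [i [j [a [ij eX]]]] := sE X (mem_head _ _).
  exists (rcons t (elementary_mx i j (- a))).
    move=> Y; rewrite mem_rcons inE => /orP[/eqP ->|/tE//].
    by exists i, j, (- a).
  by rewrite -cats1 big_cat big_seq1 /= -NX -mulrA eX elementary_mxK// mulr1.
Qed.

End SpecialLinear.
Arguments special_linear : clear implicits.
Arguments elementary_mxs : clear implicits.
Arguments elementary_group : clear implicits.

(* R[i] with the metric topology given by its modulus, as a normed module over
   itself. *)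
HB.instance Definition _ (R : realType) := NormedModule.copy R[i] R[i]^o.

Section Domains.
Variables (R : realType) (d : nat).
Local Notation C := R[i].

Definition open_polydisc : set 'rV[C]_d := [set z | forall i, `|z ord0 i| < 1].
Definition closed_polydisc : set 'rV[C]_d :=
  [set z | forall i, `|z ord0 i| <= 1].
Definition open_ball : set 'rV[C]_d :=
  [set z | \sum_i `|z ord0 i| ^+ 2 < 1].
Definition closed_ball : set 'rV[C]_d :=
  [set z | \sum_i `|z ord0 i| ^+ 2 <= 1].

Lemma open_open_polydisc : open open_polydisc.
Proof.
rewrite (_ : open_polydisc = ball 0 1); first exact: ball_open.
apply/seteqP; split => z; last by case=> _ h i; move: (h ord0 i); rewrite -ball_normE /= !mxE sub0r normrN.
move=> zU; split => // i j; rewrite ord1 -ball_normE /= !mxE sub0r normrN.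
exact: zU.
Qed.

Lemma open_polydisc_sub : open_polydisc `<=` closed_polydisc.
Proof. by move=> z zU i; exact/ltW. Qed.

Lemma open_open_ball : open open_ball.
Proof.
rewrite openE => z zU; rewrite /interior /=.
pose q (z : 'rV[C]_d) : C := \sum_i `|z ord0 i| ^+ 2.
have qreal w : q w \is Num.real.
  by rewrite ger0_real // sumr_ge0 // => i _; rewrite exprn_ge0.
have cq : {for z, continuous q}.
  move: z {zU}; apply: continuous_big => [|i _ z]; first exact: add_continuous.
  apply: (@continuousM _ _ (fun w : 'rV[C]_d => `|w ord0 i|));
    exact/(continuous_comp (@coord_continuous _ _ _ _ _ _) (@norm_continuous _ _ _)).
have /cvgrPdist_lt/(_ (1 - q z)) := cq.
rewrite subr_gt0 => /(_ zU); apply: filterS => w; rewrite distrC => h.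
have : q w - q z < 1 - q z.
  by apply: le_lt_trans h; apply: real_ler_norm; rewrite realB.
by rewrite ltrD2r.
Qed.

Lemma open_ball_sub : open_ball `<=` closed_ball.
Proof. by move=> z; exact: ltW. Qed.

End Domains.
Arguments open_polydisc : clear implicits.
Arguments closed_polydisc : clear implicits.
Arguments open_ball : clear implicits.
Arguments closed_ball : clear implicits.

Section Holomorphic.
Variables (R : realType) (d : nat) (K U : set 'rV[R[i]]_d).

(* valL_ 0 f is the extension of f by 0 outside K; for U open and contained in
   K its differentiability at the points of U does not depend on the values
   chosen outside K. The scalars are R[i], so differentiable is the complex
   Frechet differentiability in d variables. *)
Definition continuous_holomorphic : {pred K -> R[i]} :=
  mem [set f : K -> R[i] | continuous f /\
    forall z, U z -> differentiable (valL_ 0 f) z].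

Lemma valL0E (f : K -> R[i]) z (zK : z \in K) : valL_ 0 f z = f (SigSub zK).
Proof. by rewrite /valL_ /= oinv_set_val insubT. Qed.

Lemma valL0N (f : K -> R[i]) z : z \notin K -> valL_ 0 f z = 0.
Proof. by move=> zK; rewrite /valL_ /= oinv_set_val insubN. Qed.

Lemma differentiable_near (f g : 'rV[R[i]]_d -> R[i]) z :
  {near z, f =1 g} -> differentiable f z -> differentiable g z.
Proof.
move=> fg /diff_locallyP[cdf dfE].
have gE : g \o shift z = cst (g z) + 'd f z +o_ 0 id.
  apply/eqaddoP => e e0; move/eqaddoP/(_ _ e0): dfE => dfE.
  have fgz : f z = g z := nbhs_singleton fg.
  move: fg; rewrite (near_shift 0) subr0 => fg.
  near=> h.
  have /= fgh : f (h + z) = g (h + z) by near: h.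
  have : `|(f \o shift z - (cst (f z) + 'd f z)) h| <= e * `|id h| by near: h.
  by rewrite /= !fctE /= fgz fgh.
by apply/diff_locallyP; rewrite (diff_unique cdf gE).
Unshelve. all: by end_near. Qed.

Lemma continuous_holomorphic_subring : open U -> U `<=` K ->
  subring_closed continuous_holomorphic.
Proof.
move=> oU UK; split.
- rewrite inE; split; first by move=> x; exact: cst_continuous.
  move=> z Uz; apply: (@differentiable_near (cst 1)); last exact: differentiable_cst.
  have : \forall w \near z, U w by exact: open_nbhs_nbhs.
  by apply: filterS => w /UK/mem_set wK; rewrite (valL0E _ wK).
- move=> f g; rewrite !inE => -[cf df] [cg dg]; split.
    by move=> x; apply: continuousB; [exact: cf|exact: cg].
  move=> z Uz; rewrite (_ : valL_ 0 (f - g) = valL_ 0 f - valL_ 0 g).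
    by apply: differentiableB; [exact: df|exact: dg].
  apply/funext => w; rewrite [RHS](_ : _ = valL_ 0 f w - valL_ 0 g w)//.
  have [wK|wK] := boolP (w \in K).
    by rewrite !(valL0E _ wK).
  by rewrite !(valL0N _ wK) subr0.
- move=> f g; rewrite !inE => -[cf df] [cg dg]; split.
    by move=> x; apply: continuousM; [exact: cf|exact: cg].
  move=> z Uz; rewrite (_ : valL_ 0 (f * g) = valL_ 0 f * valL_ 0 g).
    by apply: differentiableM; [exact: df|exact: dg].
  apply/funext => w; rewrite [RHS](_ : _ = valL_ 0 f w * valL_ 0 g w)//.
  have [wK|wK] := boolP (w \in K).
    by rewrite !(valL0E _ wK).
  by rewrite !(valL0N _ wK) mulr0.
Qed.
End Holomorphic.
Arguments continuous_holomorphic {R d} K U.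

Section FiniteSums.
Variable T : choiceType.
Implicit Types P Q : set T.

Lemma ler_fsumr (R : numDomainType) P (F G : T -> R) : finite_set P ->
  (forall i, P i -> F i <= G i) -> \sum_(i \in P) F i <= \sum_(i \in P) G i.
Proof.
move=> fP FG; rewrite !fsbig_finite//= big_seq [leRHS]big_seq.
by apply: ler_sum => i; rewrite in_fset_set// inE => /FG.
Qed.

Lemma ler_fsum_subset (R : numDomainType) P Q (F : T -> R) :
  finite_set Q -> P `<=` Q -> (forall i, Q i -> 0 <= F i) ->
  \sum_(i \in P) F i <= \sum_(i \in Q) F i.
Proof.
move=> fQ PQ F0; rewrite (fsbigID P Q)//= (_ : Q `&` P = P); last first.
  by rewrite setIC; exact/setIidl.
by rewrite lerDl fsumr_ge0// => i [/F0].
Qed.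

Lemma normc_fsum (R : rcfType) P (F : T -> R[i]) : finite_set P ->
  Normc.normc (\sum_(i \in P) F i) <= \sum_(i \in P) Normc.normc (F i).
Proof.
move=> fP; rewrite !fsbig_finite//=.
elim/big_rec2: _ => [|i x y _ le]; first by rewrite Normc.normc0.
by apply: le_trans (le_normcD _ _) _; rewrite lerD2l.
Qed.
End FiniteSums.

Section Wiener.
Variables (R : realType) (d : nat).
Local Notation C := R[i].
Local Notation normc := Normc.normc.

Definition multi_index := {ffun 'I_d -> nat}.

Definition multi_cube (N : nat) : set multi_index :=
  [set k | forall i, (k i < N)%N].

Definition monomial (z : 'rV[C]_d) (k : multi_index) : C :=
  \prod_i z ord0 i ^+ k i.

(* The series is absolutely convergent on the closed polydisc, hence its sum
   can be computed along the cubes { k | k_1, ..., k_d < N }. *)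
Definition abs_power_series : {pred closed_polydisc R d -> C} :=
  mem [set f : closed_polydisc R d -> C | exists a : multi_index -> C,
    (\esum_(k in [set: multi_index]) (normc (a k))%:E < +oo)%E /\
    forall z : closed_polydisc R d,
      \sum_(k \in multi_cube N) a k * monomial (set_val z) k @[N --> \oo]
        --> f z].

Let add_mi (k l : multi_index) : multi_index := [ffun i => (k i + l i)%N].

Let normcC (x : C) : `|x| = (normc x)%:C%C. Proof. by []. Qed.

Let normc_ge0 (x : C) : 0 <= normc x.
Proof. by rewrite -lecR -normcC normr_ge0. Qed.

Lemma finite_multi_cube N : finite_set (multi_cube N).
Proof.
pose h (g : {ffun 'I_d -> 'I_N}) : multi_index := [ffun i => nat_of_ord (g i)].
rewrite (_ : multi_cube N = h @` setT); first exact/finite_image.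
apply/seteqP; split => [k kN|_ [g _ <-] i]; last by rewrite ffunE.
by exists [ffun i => Ordinal (kN i)] => //; apply/ffunP => i; rewrite !ffunE.
Qed.

Lemma multi_cube_sub M N : (M <= N)%N -> multi_cube M `<=` multi_cube N.
Proof. by move=> MN k kM i; exact: leq_trans (kM i) MN. Qed.

Lemma finite_sub_cube (F : set multi_index) :
  finite_set F -> exists N, F `<=` multi_cube N.
Proof.
move=> fF; exists (\max_(k <- finmap.enum_fset (fset_set F)) \max_i k i).+1 => k Fk i.
rewrite ltnS; apply: leq_trans (leq_bigmax i) _.
by apply: leq_bigmax_seq => //; rewrite in_fset_set// inE.
Qed.

Let A (a : multi_index -> C) N := \sum_(k \in multi_cube N) normc (a k).

Let A_ge0 a N : 0 <= A a N. Proof. by apply: fsumr_ge0 => k _; exact: normc_ge0. Qed.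

Let A_mono a : {homo A a : m n / (m <= n)%N >-> m <= n}.
Proof.
move=> m n mn; apply: ler_fsum_subset; first exact: finite_multi_cube.
  exact: multi_cube_sub.
by move=> k _; exact: normc_ge0.
Qed.

Lemma summableP a : (\esum_(k in [set: multi_index]) (normc (a k))%:E < +oo)%E <->
  exists M, forall N, A a N <= M.
Proof.
split=> [fin|[M AM]].
  have fn : (\esum_(k in [set: multi_index]) (normc (a k))%:E)%E \is a fin_num.
    by rewrite ge0_fin_numE// esum_ge0// => k _; rewrite lee_fin normc_ge0.
  exists (fine (\esum_(k in [set: multi_index]) (normc (a k))%:E)%E) => N.
  rewrite -lee_fin fineK//; apply: esum_ge; exists (multi_cube N).
    by split => //; exact: finite_multi_cube.
  by rewrite fsumEFin//; exact: finite_multi_cube.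
apply: (@le_lt_trans _ _ M%:E); last exact: ltry.
apply: ge_ereal_sup => _ [F [fF _] <-]; rewrite fsumEFin// lee_fin.
have [N FN] := finite_sub_cube fF.
by apply: le_trans (AM N); apply: ler_fsum_subset => //; exact: finite_multi_cube.
Qed.

Let A_cvg a M : (forall N, A a N <= M) -> cvgn (A a).
Proof.
move=> AM; apply: nondecreasing_is_cvgn; first exact: A_mono.
by exists M => _ [N _ <-].
Qed.

Let tri N := [set p : multi_index * multi_index | multi_cube N (add_mi p.1 p.2)].

Let conv (K : idomainType) (u v : multi_index -> K) k :=
  \sum_(p \in [set p : multi_index * multi_index | add_mi p.1 p.2 = k])
    u p.1 * v p.2.

Let tri_sub N : tri N `<=` multi_cube N `*` multi_cube N.
Proof.
move=> [k l] /= kl; split=> i /=; apply: leq_ltn_trans (kl i); rewrite ffunE.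
  exact: leq_addr.
exact: leq_addl.
Qed.

Let sub_tri N : multi_cube N./2 `*` multi_cube N./2 `<=` tri N.
Proof.
move=> [k l] [/= kN lN] i; rewrite ffunE /= -[N]odd_double_half -addnn.
apply: (@leq_trans (N./2 + N./2)%N); last exact: leq_addl.
by rewrite -addSn leq_add// ltnW.
Qed.

Let finite_sq N : finite_set (multi_cube N `*` multi_cube N).
Proof. by apply: finite_setX; exact: finite_multi_cube. Qed.

Let finite_tri N : finite_set (tri N).
Proof. exact: sub_finite_set (@tri_sub N) (finite_sq N). Qed.

Let finite_fiber k : finite_set
  [set p : multi_index * multi_index | add_mi p.1 p.2 = k].
Proof.
have [N kN] := finite_sub_cube (finite_set1 k).
by apply: sub_finite_set (finite_tri N) => p /= e; apply: kN.
Qed.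

Let sum_conv (K : idomainType) (u v : multi_index -> K) N :
  \sum_(k \in multi_cube N) conv u v k = \sum_(p \in tri N) u p.1 * v p.2.
Proof.
pose G (k : multi_index) (p : multi_index * multi_index) : K :=
  if add_mi p.1 p.2 == k then u p.1 * v p.2 else 0.
transitivity (\sum_(k \in multi_cube N) \sum_(p \in tri N) G k p).
  apply: eq_fsbigr => k /set_mem kN; rewrite /conv.
  transitivity (\sum_(p \in [set p | add_mi p.1 p.2 = k]) G k p).
    by apply: eq_fsbigr => p /set_mem /= e; rewrite /G e eqxx.
  apply: fsbig_widen; first by move=> p /= e; rewrite /tri /= e.
  by move=> p [_ /=] /eqP/negbTE; rewrite /G => ->.
rewrite exchange_fsbig//; last exact: finite_multi_cube.
apply: eq_fsbigr => p /set_mem pN.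
rewrite -(@fsbig_widen _ _ _ _ [set add_mi p.1 p.2]).
- by rewrite fsbig_set1 /G eqxx.
- by move=> k ->.
- by move=> k [_ /=] /eqP; rewrite /G eq_sym => /negbTE ->.
Qed.

Let sum_sq (K : idomainType) (u v : multi_index -> K) N :
  (\sum_(k \in multi_cube N) u k) * (\sum_(k \in multi_cube N) v k) =
  \sum_(p \in multi_cube N `*` multi_cube N) u p.1 * v p.2.
Proof.
rewrite mulr_fsuml -(@pair_fsbig _ _ _ _ _ _ _ (fun k l => u k * v l)).
- by apply: eq_fsbigr => k _; rewrite mulr_fsumr.
- exact: finite_multi_cube.
- exact: finite_multi_cube.
Qed.

Let A_conv a b N : A (conv a b) N <= A a N * A b N.
Proof.
have h : A (conv a b) N <=
    \sum_(k \in multi_cube N) @conv R (fun l => normc (a l)) (fun l => normc (b l)) k.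
  apply: ler_fsumr => [|k _]; first exact: finite_multi_cube.
  apply: le_trans (normc_fsum _ _) _ => //.
  by apply: ler_fsumr => // p _; rewrite Normc.normcM.
apply: le_trans h _; rewrite sum_conv [leRHS]sum_sq.
apply: ler_fsum_subset => // p _.
by rewrite mulr_ge0 ?normc_ge0.
Qed.

Let conv_tail (a b u v : multi_index -> C) N :
  (forall k, normc (u k) <= normc (a k)) ->
  (forall k, normc (v k) <= normc (b k)) ->
  normc ((\sum_(k \in multi_cube N) u k) * (\sum_(k \in multi_cube N) v k) -
    \sum_(k \in multi_cube N) conv u v k) <=
  A a N * A b N - A a N./2 * A b N./2.
Proof.
move=> ua vb; rewrite sum_sq sum_conv (fsbigID (tri N) (_ `*` _))//=.
rewrite (_ : _ `&` tri N = tri N); last first.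
  by rewrite setIC; exact/setIidl/tri_sub.
rewrite addrAC subrr add0r; set B := _ `&` ~` _.
have fB : finite_set B by apply: sub_finite_set (finite_sq N) => p [].
apply: (@le_trans _ _ (\sum_(p \in B) normc (a p.1) * normc (b p.2))).
  apply: le_trans (normc_fsum _ _) _ => //.
  apply: ler_fsumr => // p _; rewrite Normc.normcM.
  by apply: ler_pM; rewrite ?normc_ge0.
rewrite lerBrDl /A !sum_sq.
rewrite [leRHS](fsbigID (tri N) (_ `*` _))//= lerD2r.
rewrite (_ : _ `&` tri N = tri N); last first.
  by rewrite setIC; exact/setIidl/tri_sub.
apply: ler_fsum_subset => // p _; by rewrite mulr_ge0 ?normc_ge0.
Qed.

Let monomialD z k l : monomial z (add_mi k l) = monomial z k * monomial z l.
Proof.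
by rewrite -big_split /=; apply: eq_bigr => i _; rewrite ffunE exprD.
Qed.

Let normc_monomial (z : closed_polydisc R d) k :
  normc (monomial (set_val z) k) <= 1.
Proof.
rewrite -lecR -normcC normr_prod; apply: prodr_ile1 => i _.
rewrite normr_ge0 /= normrX exprn_ile1 ?normr_ge0//.
exact: (set_valP z).
Qed.

Let normc_term a (z : closed_polydisc R d) k :
  normc (a k * monomial (set_val z) k) <= normc (a k).
Proof. by rewrite Normc.normcM ler_piMr ?normc_ge0. Qed.

Lemma cvg_half : (fun N : nat => N./2) @ \oo --> \oo.
Proof.
move=> P [M _ MP]; exists M.*2 => // N /= MN; apply: MP => /=.
by rewrite -(doubleK M) half_leq.
Qed.

Let sum_dirac (K : idomainType) (F : multi_index -> K) N :
  (forall k, k != [ffun=> 0%N] -> F k = 0) ->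
  \sum_(k \in multi_cube N.+1) F k = F [ffun=> 0%N].
Proof.
move=> F0; rewrite -(@fsbig_widen _ _ _ _ [set [ffun=> 0%N]]) ?fsbig_set1//.
  by move=> _ -> i; rewrite ffunE.
by move=> k [_ /= /eqP k0]; exact: F0.
Qed.

Lemma abs_power_series_subring : subring_closed abs_power_series.
Proof.
split.
- rewrite inE; exists (fun k => (k == [ffun=> 0%N])%:R); split.
    apply/summableP; exists 1 => N; apply: le_trans (A_mono _ (leqnSn N)) _.
    rewrite /A sum_dirac ?eqxx ?Normc.normc1//.
    by move=> k /negbTE ->; exact: Normc.normc0.
  move=> z; apply: cvg_near_cst.
  exists 1%N => // -[//|N] _; rewrite sum_dirac => [|k /negbTE ->]; last first.
    by rewrite mul0r.
  rewrite eqxx mul1r /monomial big1// => i _.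
  by rewrite ffunE expr0.
- move=> f g /set_mem[a [/summableP[M AM] fE]] /set_mem[b [/summableP[M' BM] gE]].
  apply/mem_set.
  exists (fun k => a k - b k); split.
    apply/summableP; exists (M + M') => N; apply: le_trans (lerD (AM N) (BM N)).
    rewrite /A -fsbig_split; last exact: finite_multi_cube.
    apply: ler_fsumr => [|k _]; first exact: finite_multi_cube.
    by apply: le_trans (le_normcD _ _) _; rewrite normcN.
  move=> z; rewrite (_ : (f - g) z = f z - g z)//.
  apply: cvg_trans (cvgB (fE z) (gE z)); apply: near_eq_cvg; apply: nearW => N.
  rewrite /= !fctE !fsbig_finite//=; try exact: finite_multi_cube.
  by rewrite -sumrB; apply: eq_bigr => k _; rewrite mulrBl.
- move=> f g /set_mem[a [/summableP[M AM] fE]] /set_mem[b [/summableP[M' BM] gE]].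
  apply/mem_set.
  exists (conv a b); split.
    apply/summableP; exists (M * M') => N; apply: le_trans (A_conv _ _ _) _.
    by apply: ler_pM; rewrite ?A_ge0.
  move=> z.
  pose u k := a k * monomial (set_val z) k.
  pose v k := b k * monomial (set_val z) k.
  pose S (w : multi_index -> C) N := \sum_(k \in multi_cube N) w k.
  have -> : (fun N => \sum_(k \in multi_cube N) conv a b k * monomial (set_val z) k)
      = (fun N => S u N * S v N - (S u N * S v N - S (conv u v) N)).
    apply/funext => N; rewrite opprB addrCA subrr addr0; apply: eq_fsbigr => k _.
    rewrite /conv mulr_fsuml; apply: eq_fsbigr => p /set_mem /= <-.
    by rewrite monomialD mulrACA.
  rewrite -[(f * g) z]subr0; apply: cvgB.
    by apply: cvgM; [exact: fE|exact: gE].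
  apply/cvgr0Pnorm_lt => -[x y]; rewrite ltcE /= => /andP[/eqP -> x0].
  have ca := A_cvg AM; have cb := A_cvg BM.
  have D0 : (A a N * A b N - A a N./2 * A b N./2) @[N --> \oo] --> (0 : R).
    rewrite -(subrr (limn (A a) * limn (A b))); apply: cvgB.
      exact: cvgM.
    apply: cvgM.
      exact: (cvg_comp _ _ cvg_half ca).
    exact: (cvg_comp _ _ cvg_half cb).
  have /(_ _ _ x0) := cvgr_lt _ D0; apply: filterS => N DN.
  rewrite normcC ltcR; apply: le_lt_trans DN; apply: conv_tail => k;
    exact: normc_term.
Qed.

End Wiener.

Section PolydiscAlgebra.
Variables (R : realType) (d : nat).

Definition polydisc_pred : {pred closed_polydisc R d -> R[i]} :=
  continuous_holomorphic (closed_polydisc R d) (open_polydisc R d).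

Record polydisc_algebra := PolydiscAlgebra
  { polydisc_fun :> closed_polydisc R d -> R[i] ; _ : polydisc_fun \in polydisc_pred }.

HB.instance Definition _ := [isSub for polydisc_fun].
HB.instance Definition _ := [Choice of polydisc_algebra by <:].
HB.instance Definition _ := GRing.isSubringClosed.Build (closed_polydisc R d -> R[i])
  polydisc_pred (continuous_holomorphic_subring
    (@open_open_polydisc R d) (@open_polydisc_sub R d)).
HB.instance Definition _ := 
  GRing.SubChoice_isSubComPzRing.Build _ _ polydisc_algebra (subringClosedP _).

Fact polydisc_algebra_oner_neq0 : (1 : polydisc_algebra) != 0.
Proof.
have z0 : closed_polydisc R d 0.
  by move=> i; rewrite mxE normr0 ler01.
apply/eqP => /(congr1 polydisc_fun)/(congr1 (fun f => f (SigSub (mem_set z0)))).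
exact/eqP/oner_neq0.
Qed.
HB.instance Definition _ := GRing.PzSemiRing_isNonZero.Build polydisc_algebra
  polydisc_algebra_oner_neq0.

End PolydiscAlgebra.
Arguments polydisc_algebra : clear implicits.

Section BallAlgebra.
Variables (R : realType) (d : nat).

Definition ball_pred : {pred closed_ball R d -> R[i]} :=
  continuous_holomorphic (closed_ball R d) (open_ball R d).

Record ball_algebra := BallAlgebra
  { ball_fun :> closed_ball R d -> R[i] ; _ : ball_fun \in ball_pred }.

HB.instance Definition _ := [isSub for ball_fun].
HB.instance Definition _ := [Choice of ball_algebra by <:].
HB.instance Definition _ := GRing.isSubringClosed.Build (closed_ball R d -> R[i])
  ball_pred (continuous_holomorphic_subring
    (@open_open_ball R d) (@open_ball_sub R d)).
HB.instance Definition _ := 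
  GRing.SubChoice_isSubComPzRing.Build _ _ ball_algebra (subringClosedP _).

Fact ball_algebra_oner_neq0 : (1 : ball_algebra) != 0.
Proof.
have z0 : closed_ball R d 0.
  by rewrite /closed_ball /= big1 ?ler01// => i _; rewrite mxE normr0 expr0n.
apply/eqP => /(congr1 ball_fun)/(congr1 (fun f => f (SigSub (mem_set z0)))).
exact/eqP/oner_neq0.
Qed.
HB.instance Definition _ := GRing.PzSemiRing_isNonZero.Build ball_algebra
  ball_algebra_oner_neq0.

End BallAlgebra.
Arguments ball_algebra : clear implicits.

Section WienerAlgebra.
Variables (R : realType) (d : nat).

Record wiener_algebra := WienerAlgebra
  { wiener_fun :> closed_polydisc R d -> R[i] ; _ : wiener_fun \in (@abs_power_series R d) }.

HB.instance Definition _ := [isSub for wiener_fun].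
HB.instance Definition _ := [Choice of wiener_algebra by <:].
HB.instance Definition _ := GRing.isSubringClosed.Build (closed_polydisc R d -> R[i])
  (@abs_power_series R d) (@abs_power_series_subring R d).
HB.instance Definition _ := 
  GRing.SubChoice_isSubComPzRing.Build _ _ wiener_algebra (subringClosedP _).

Fact wiener_algebra_oner_neq0 : (1 : wiener_algebra) != 0.
Proof.
have z0 : closed_polydisc R d 0.
  by move=> i; rewrite mxE normr0 ler01.
apply/eqP => /(congr1 wiener_fun)/(congr1 (fun f => f (SigSub (mem_set z0)))).
exact/eqP/oner_neq0.
Qed.
HB.instance Definition _ := GRing.PzSemiRing_isNonZero.Build wiener_algebra
  wiener_algebra_oner_neq0.

End WienerAlgebra.
Arguments wiener_algebra : clear implicits.

(* Main.v *)
From HB Require Import structures.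
Require Import Defs.
From mathcomp Require Import all_boot all_order all_algebra.
From mathcomp Require Import complex ring lra zify.
From mathcomp Require Import all_classical all_reals all_analysis.

(* For f in R and 0 <= t <= 1 the dilation f_t(z) = f(tz) is again in R and
   depends continuously on t in the norm of R, so a matrix M of determinant 1
   is joined to the constant matrix M_0 = M(0) by the path M_t.  By uniform
   continuity M = M_0 * (M_0^-1 M_{1/N}) * ... * (M_{(N-1)/N}^-1 M_1) with all
   factors but the first close to the identity.  The constant factor is
   elementary by Gaussian elimination over the field of complex numbers; the
   others are, because their trailing principal minors are close to 1, hence
   invertible in R: for the sup norm since 1/f is again in the algebra when f
   has no zero, for the Wiener norm by the geometric series. *)

Set Implicit Arguments.
Unset Strict Implicit.
Unset Printing Implicit Defensive.

Import Order.TTheory GRing.Theory Num.Theory numFieldNormedType.Exports.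

Local Open Scope classical_set_scope.
Local Open Scope ring_scope.

(** * Elementary matrices *)

Section ElementaryGroup.
Variable A : comPzRingType.
Implicit Types m n : nat.

(** Sizes of ring elements enter only through a relation [bnd], closed under sums and products and
    forcing invertibility within 1/3 of 1, so one argument serves both norms: for the Wiener norm it
    asks for some family of coefficients of l1 norm at most [r]. Since [\det M_s = 1], the inverse
    of [M_s] is its adjugate, and the minors of a factor are polynomials in dilates of entries of
    [\adj M] and [M] at two parameters [s] and [t]. A single subdivision must work along the whole
    path, so these minors have to be close to 1 uniformly in [s] when [t] is near [s]; this is the
    property called [tame]. Dilation suits all three algebras: it maps the domains into themselves
    and multiplies power series coefficients by numbers in [0, 1]. *)

Lemma elementary_group_subgroup n : SL_subgroup (elementary_group A n).
Proof.
split.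
- move=> M; apply; split=> [|M' [i [j [a [ij ->]]]]]; last exact: det_elementary_mx.
  split=> //=; rewrite /special_linear /=; first exact: det1.
    by move=> M1 M2 d1 d2; rewrite det_mulmx d1 d2 mulr1.
  by move=> M1 M2 d1 /(congr1 determinant); rewrite det_mulmx d1 det1 mul1r.
- by move=> H [[]].
- move=> M N EM EN H EH; have [[_ _ HM _] _] := EH.
  by apply: HM; [exact: EM|exact: EN].
- move=> M N EM MN NM H EH; have [[_ _ _ HV] _] := EH.
  by apply: HV MN NM; exact: EM.
Qed.

Lemma elementary_group_det n (M : 'M[A]_n) : elementary_group A n M -> \det M = 1.
Proof. by have [/(_ M)] := elementary_group_subgroup n. Qed.

Lemma elementary_group1 n : elementary_group A n 1%:M.
Proof. by have [] := elementary_group_subgroup n. Qed.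

Lemma elementary_groupM n (M N : 'M[A]_n) :
  elementary_group A n M -> elementary_group A n N -> elementary_group A n (M *m N).
Proof. by have [_ _ + _] := elementary_group_subgroup n; exact. Qed.

Lemma elementary_group_mx n i j a : i != j ->
  elementary_group A n (elementary_mx i j a).
Proof. by move=> ij H [_]; apply; exists i, j, a. Qed.

(** As [\det X = 1], [\adj X] is the inverse of [X] and lies in the group; hence a matrix may be
    replaced by any row reduction of it. *)
Lemma elementary_group_cancel n (X M : 'M[A]_n) :
  elementary_group A n X -> elementary_group A n (X *m M) ->
  elementary_group A n M.
Proof.
move=> EX EXM; have dX := elementary_group_det EX.
rewrite -[M]mul1mx -dX -mul_adj_mx -mulmxA; apply: elementary_groupM => //.
have [_ _ _] := elementary_group_subgroup n; apply; first exact: EX.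
  by rewrite -mulmxE mul_mx_adj dX.
by rewrite -mulmxE mul_adj_mx dX.
Qed.

(** Such matrices multiply by adding their columns [c], so expanding [c] in the standard basis
    factors them. *)
Lemma elementary_group_lower n (c : 'cV[A]_n) :
  elementary_group A (1 + n) (block_mx 1%:M 0 c 1%:M).
Proof.
rewrite [c]matrix_sum_delta.
elim/big_rec: _ => [|i x _ Ex]; first by rewrite -scalar_mx_block; exact: elementary_group1.
rewrite big_ord1.
suff -> : block_mx 1%:M 0 (c i 0 *: delta_mx i 0 + x) 1%:M =
    elementary_mx (rshift 1 i) (lshift n 0) (c i 0) *m block_mx 1%:M 0 x 1%:M.
  by apply: elementary_groupM => //; exact: elementary_group_mx.
have -> : elementary_mx (rshift 1 i) (lshift n 0) (c i 0) =
    block_mx 1%:M 0 (c i 0 *: delta_mx i 0) 1%:M.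
  rewrite /elementary_mx (scalar_mx_block 1 n) [delta_mx _ _](_ : _ =
    block_mx 0 0 (delta_mx i 0) 0); last first.
    rewrite -[LHS]submxK; congr block_mx; apply/matrixP => p q;
      by rewrite !mxE ?eq_lrshift ?eq_rlshift ?andbF ?(inj_eq (@rshift_inj _ _))
        ?(inj_eq (@lshift_inj _ _)).
  by rewrite scale_block_mx add_block_mx !(scaler0, add0r, addr0).
by rewrite mulmx_block !(mul0mx, mulmx0, mul1mx, mulmx1, addr0, add0r).
Qed.

Lemma elementary_group_tr n (M : 'M[A]_n) :
  elementary_group A n M -> elementary_group A n M^T.
Proof.
move=> /elementary_groupP[s sE ->]; elim: s sE => [|X s IH] sE.
  by rewrite big_nil trmx1; exact: elementary_group1.
rewrite big_cons -mulmxE trmx_mul; apply: elementary_groupM.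
  by apply: IH => Y Ys; apply: sE; rewrite inE Ys orbT.
have [i [j [a [ij ->]]]] := sE X (mem_head _ _).
rewrite /elementary_mx raddfD /= tr_scalar_mx linearZ /= trmx_delta.
by apply: elementary_group_mx; rewrite eq_sym.
Qed.

Lemma elementary_group_upper n (r : 'rV[A]_n) :
  elementary_group A (1 + n) (block_mx 1%:M r 0 1%:M).
Proof.
rewrite -[block_mx _ _ _ _]trmxK; apply: elementary_group_tr.
by rewrite tr_block_mx !trmx1 trmx0; exact: elementary_group_lower.
Qed.

Lemma elementary_group_lift n (D : 'M[A]_n) : elementary_group A n D ->
  elementary_group A (1 + n) (block_mx 1%:M 0 0 D).
Proof.
move=> /elementary_groupP[s sE ->]; elim: s sE => [|X s IH] sE.
  by rewrite big_nil -scalar_mx_block; exact: elementary_group1.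
rewrite big_cons -mulmxE.
have -> : block_mx 1%:M 0 0 (X *m \prod_(Y <- s) Y) =
    block_mx 1%:M 0 0 X *m (block_mx 1%:M 0 0 (\prod_(Y <- s) Y) : 'M[A]_(1 + n)).
  by rewrite mulmx_block !(mul0mx, mulmx0, mul1mx, mulmx1, addr0, add0r).
apply: elementary_groupM; last first.
  by apply: IH => Y Ys; apply: sE; rewrite inE Ys orbT.
have [i [j [a [ij ->]]]] := sE X (mem_head _ _).
suff -> : block_mx 1%:M 0 0 (elementary_mx i j a) =
    elementary_mx (rshift 1 i) (rshift 1 j) a.
  by apply: elementary_group_mx; rewrite (inj_eq (@rshift_inj _ _)).
rewrite /elementary_mx (scalar_mx_block 1 n) [in RHS](_ : delta_mx _ _ =
  block_mx 0 0 0 (delta_mx i j)); last first.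
  rewrite -[LHS]submxK; congr block_mx; apply/matrixP => p q;
    by rewrite !mxE ?eq_lrshift ?andbF ?(inj_eq (@rshift_inj _ _)).
by rewrite scale_block_mx add_block_mx !(scaler0, add0r, addr0).
Qed.

(** Block elimination with pivot 1: [D - c *m r] is the Schur complement of the corner. *)
Lemma elementary_group_block n (r : 'rV[A]_n) (c : 'cV[A]_n) (D : 'M[A]_n) :
  elementary_group A n (D - c *m r) ->
  elementary_group A (1 + n) (block_mx 1%:M r c D).
Proof.
move=> /elementary_group_lift ED.
have -> : block_mx 1%:M r c D = block_mx 1%:M 0 c 1%:M *m
    block_mx 1%:M 0 0 (D - c *m r) *m block_mx 1%:M r 0 1%:M.
  rewrite !mulmx_block !(mul0mx, mulmx0, mul1mx, mulmx1, addr0, add0r).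
  by rewrite subrKC.
apply: elementary_groupM (elementary_group_upper r).
exact: elementary_groupM (elementary_group_lower c) ED.
Qed.

Lemma det_block1 n (r : 'rV[A]_n) (c : 'cV[A]_n) (D : 'M[A]_n) :
  \det (block_mx 1%:M r c D) = \det (D - c *m r).
Proof.
have -> : block_mx 1%:M r c D = block_mx 1%:M 0 c 1%:M *m
    (block_mx 1%:M r 0 (D - c *m r) : 'M[A]_(1 + n)).
  by rewrite mulmx_block !(mul0mx, mulmx0, mul1mx, mulmx1, addr0, add0r) subrKC.
by rewrite det_mulmx det_lblock det_ublock !det1 !mul1r.
Qed.

(** The minors are those of the lower right blocks of sizes n - 1 down to 0. [\det M] itself is left
    out, so the condition ignores the first row of [M]. An explicit inverse [q] expresses
    invertibility over a general commutative ring. *)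
Fixpoint trailing_minors_unit n : 'M[A]_n -> Prop :=
  if n is m.+1 then fun M : 'M[A]_(1 + m) =>
    (exists q, \det (drsubmx M) * q = 1) /\ trailing_minors_unit (drsubmx M)
  else fun=> True.

(* Clearing the first row and column with the invertible block D leaves
   diag(s, D) with s * \det D = 1; two row operations then turn s into 1, at
   the cost of scaling the first row of D by s, which does not affect the
   trailing minors. *)
Lemma elementary_group_trailing n (M : 'M[A]_n) :
  trailing_minors_unit M -> \det M = 1 -> elementary_group A n M.
Proof.
elim: n M => [|[|n] IH] M.
- by move=> _ _; rewrite (flatmx0 M) -(flatmx0 1%:M); exact: elementary_group1.
- move=> _; rewrite [M]mx11_scalar det_scalar1 => ->; exact: elementary_group1.
case=> -[q]; rewrite -[M](@submxK _ 1 n.+1 1) block_mxKdr.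
set a := ulsubmx _; set r := ursubmx _; set c := dlsubmx _; set D := drsubmx _.
move=> Dq tD dM.
pose V := q *: \adj D.
have DV : D *m V = 1%:M by rewrite -scalemxAr mul_mx_adj -mul_scalar_mx -scalar_mxM mulrC Dq.
have VD : V *m D = 1%:M by rewrite -scalemxAl mul_adj_mx -mul_scalar_mx -scalar_mxM mulrC Dq.
pose s := a - r *m V *m c.
have eM : block_mx a r c D =
    block_mx 1%:M (r *m V) 0 1%:M *m block_mx s 0 0 D *m
    (block_mx 1%:M 0 (V *m c) 1%:M : 'M[A]_(1 + n.+1)).
  rewrite !mulmx_block !(mul0mx, mulmx0, mul1mx, mulmx1, addr0, add0r).
  by rewrite (mulmxA D) DV mul1mx -(mulmxA r V D) VD mulmx1 /s (mulmxA r) subrK.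
have := dM : @determinant A (1 + n.+1) (block_mx a r c D) = 1.
rewrite eM !det_mulmx !det_lblock det_ublock !det1 !mulr1 mul1r => dsD.
apply: elementary_groupM (elementary_group_lower _).
apply: elementary_groupM (elementary_group_upper _) _.
pose e : 'cV[A]_(1 + n) := col_mx 1%:M 0.
(* As [s * \det D = 1], the first operation writes [e] below [s]; the second adds [1 - s] times the
   row of that 1 to the top row, so the corner becomes 1. *)
apply: (elementary_group_cancel (elementary_group_lower (\det D *: e))).
apply: (elementary_group_cancel (elementary_group_upper (e^T - s *m e^T))).
rewrite !mulmx_block !(mul0mx, mulmx0, mul1mx, mulmx1, addr0, add0r).
have ees : \det D *: e *m s = e.
  by rewrite [s]mx11_scalar mul_mx_scalar scalerA -det_mx11 dsD scale1r.
have ee : e^T *m e = 1%:M.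
  by rewrite tr_col_mx mul_row_col trmx1 trmx0 mul1mx mul0mx addr0.
rewrite ees mulmxBl -mulmxA ee mulmx1 subrKC.
apply: elementary_group_block; rewrite mulmxA -{1}[D]mul1mx -mulmxBl.
have -> : 1%:M - e *m (e^T - s *m e^T) = block_mx s 0 0 1%:M.
  rewrite mulmxBr mulmxA tr_col_mx trmx1 trmx0 mul_col_row.
  rewrite [col_mx _ _ *m s]mul_col_mx mul_col_row !(mul0mx, mulmx0, mul1mx, mulmx1).
  rewrite (scalar_mx_block 1 n) !opp_block_mx !add_block_mx !subr0 opp_block_mx.
  by rewrite add_block_mx !(oppr0, addr0, opprB) subrKC.
apply: IH; last first.
  rewrite -[LHS]/(@determinant A (1 + n) _).
  by rewrite det_mulmx det_lblock det1 mulr1.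
have -> : block_mx s 0 0 1%:M *m D = block_mx (s *m @ulsubmx _ 1 n 1 n D)
    (s *m @ursubmx _ 1 n 1 n D) (@dlsubmx _ 1 n 1 n D) (@drsubmx _ 1 n 1 n D).
  transitivity (block_mx s 0 0 1%:M *m block_mx (@ulsubmx _ 1 n 1 n D)
    (@ursubmx _ 1 n 1 n D) (@dlsubmx _ 1 n 1 n D) (@drsubmx _ 1 n 1 n D)).
    by rewrite submxK.
  by rewrite mulmx_block !(mul0mx, mul1mx, addr0, add0r).
by case: tD => dD tD; split; rewrite block_mxKdr.
Qed.

End ElementaryGroup.

(** Rows cannot be rescaled, so the corner is made 1 by adding to the top row a multiple of a lower
    row that is nonzero in column 0. If the corner is the only nonzero entry of that column, adding
    the top row to another row creates such a row. *)
Lemma special_linear_field (F : fieldType) n (M : 'M[F]_n) :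
  \det M = 1 -> elementary_group F n M.
Proof.
elim: n M => [|n IH] M.
  by move=> _; rewrite (flatmx0 M) -(flatmx0 1%:M); exact: elementary_group1.
have pivot1 (N : 'M[F]_(1 + n)) : N 0 0 = 1 -> \det N = 1 -> elementary_group F (1 + n) N.
  move=> N00; have ul1 : ulsubmx N = 1%:M.
    apply/matrixP => i j; rewrite !ord1 !mxE -[RHS]N00.
    by congr (N _ _); exact: val_inj.
  rewrite -[N]submxK ul1 det_block1 => /IH; exact: elementary_group_block.
have [n0|n0] := posnP n.
  move: M; rewrite n0 => M; rewrite [M]mx11_scalar det_scalar1 => ->.
  exact: elementary_group1.
have pivot (N : 'M[F]_n.+1) i : i != 0 -> N i 0 != 0 -> \det N = 1 ->
    elementary_group F n.+1 N.
  move=> i0 Ni0 dN; pose E := elementary_mx 0 i ((1 - N 0 0) / N i 0).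
  have EE : elementary_group F n.+1 E by apply: elementary_group_mx; rewrite eq_sym.
  apply: (elementary_group_cancel EE); apply: pivot1; last first.
    by rewrite det_mulmx dN det_elementary_mx ?mulr1// eq_sym.
  rewrite mulmxDl mul1mx -scalemxAl mxE [X in _ + X]mxE.
  rewrite (_ : (delta_mx 0 i *m N) 0 0 = N i 0) ?divfK ?subrKC//.
  rewrite mxE (bigD1 i)//= mxE !eqxx mul1r big1 ?addr0// => j /negbTE ji.
  by rewrite mxE ji andbF mul0r.
move=> dM; have [i /andP[i0 Mi0]|Mi0] := pickP [pred i | (i != 0) && (M i 0 != 0)].
  exact: pivot i0 Mi0 dM.
have M00 : M 0 0 != 0.
  apply/eqP => M00; move: dM; rewrite (expand_det_col M 0) big1 => [/esym/eqP|i _].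
    by rewrite oner_eq0.
  have [->|i0] := eqVneq i 0; first by rewrite M00 mul0r.
  by move: (Mi0 i); rewrite /= i0 /= => /negbFE/eqP ->; rewrite mul0r.
pose k : 'I_n.+1 := Ordinal (n0 : (1 < n.+1)%N).
have EE : elementary_group F n.+1 (elementary_mx k 0 1) by exact: elementary_group_mx.
apply: (elementary_group_cancel EE); apply: (pivot _ k) => //; last first.
  by rewrite det_mulmx dM det_elementary_mx ?mulr1.
rewrite mulmxDl mul1mx scale1r mxE.
move: (Mi0 k) => /= /negbFE/eqP ->; rewrite add0r.
rewrite mxE (bigD1 0)//= mxE !eqxx mul1r big1 ?addr0// => j /negbTE ji.
by rewrite mxE ji andbF mul0r.
Qed.

(** * Contraction of a normed algebra onto its constants *)

Section Homotopy.
Variables (R : realType) (A : comPzRingType).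

(* [bnd r a] reads: the norm of [a] is at most [r]. *)
Variable bnd : R -> A -> Prop.
Hypothesis bnd_le : forall r s a, r <= s -> bnd r a -> bnd s a.
Hypothesis bnd0 : bnd 0 0.
Hypothesis bndD : forall r s a b, bnd r a -> bnd s b -> bnd (r + s) (a + b).
Hypothesis bndM : forall r s a b, bnd r a -> bnd s b -> bnd (r * s) (a * b).
Hypothesis bnd_inv : forall a, bnd 3^-1 (a - 1) -> exists b, a * b = 1.

Variable h : R -> {rmorphism A -> A}.
Hypothesis h_bnd : forall a, exists r, forall t, bnd r (h t a).
Hypothesis h_unif : forall a e, 0 < e ->
  \forall d \near 0^'+, forall s t, `|s - t| <= d -> bnd e (h s a - h t a).
Hypothesis h1 : h 1 =1 id.

Variables (F : fieldType) (iota : {rmorphism F -> A}) (ev : {rmorphism A -> F}).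
Hypothesis h0 : forall a, h 0 a = iota (ev a).

(** Here [s] is the base point and [t] the moving one: the values near the diagonal are compared
    with [phi s s], uniformly in [s]. Boundedness is what makes the property pass to products. *)
Definition tame (phi : R -> R -> A) :=
  (exists r, forall s t, bnd r (phi s t)) /\
  forall e, 0 < e -> \forall d \near 0^'+,
    forall s t, `|s - t| <= d -> bnd e (phi s t - phi s s).

Lemma tame_cst a : tame (fun _ _ => a).
Proof.
split=> [|e e0].
  (* [h 1 a = a], so a bound for all dilates of [a] bounds [a]. *)
  by have [r hr] := h_bnd a; exists r => _ _; rewrite -(h1 a).
by apply: nearW => d s t _; rewrite subrr; apply: bnd_le bnd0; exact: ltW.
Qed.

Lemma tame_left a : tame (fun s _ => h s a).
Proof.
split=> [|e e0]; first by have [r hr] := h_bnd a; exists r.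
by apply: nearW => d s t _; rewrite subrr; apply: bnd_le bnd0; exact: ltW.
Qed.

Lemma tame_right a : tame (fun _ t => h t a).
Proof.
split=> [|e e0]; first by have [r hr] := h_bnd a; exists r.
apply: filterS (h_unif a e0) => d hd s t; rewrite distrC; exact: hd.
Qed.

Lemma tameD phi psi : tame phi -> tame psi -> tame (fun s t => phi s t + psi s t).
Proof.
move=> [[r hr] phiE] [[r' hr'] psiE]; split=> [|e e0].
  by exists (r + r') => s t; exact: bndD.
have e20 : 0 < e / 2 by rewrite divr_gt0.
apply: filterS2 (phiE _ e20) (psiE _ e20) => d b1 b2 s t st.
by rewrite [e]splitr opprD addrACA; apply: bndD; [exact: b1|exact: b2].
Qed.

Lemma tameM phi psi : tame phi -> tame psi -> tame (fun s t => phi s t * psi s t).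
Proof.
move=> [[r hr] phiE] [[r' hr'] psiE]; split=> [|e e0].
  by exists (r * r') => s t; exact: bndM.
(* The 1 keeps [B] positive, as [r] and [r'] may vanish and [e / 2] is divided by [B]. *)
pose B := Num.max 1 (Num.max r r').
have B0 : 0 < B by rewrite lt_max ltr01.
have rB : r <= B by rewrite !le_max lexx orbT.
have r'B : r' <= B by rewrite !le_max lexx !orbT.
have e20 : 0 < e / 2 / B by rewrite !divr_gt0.
apply: filterS2 (phiE _ e20) (psiE _ e20) => d b1 b2 s t st.
have -> : phi s t * psi s t - phi s s * psi s s =
  (phi s t - phi s s) * psi s s + phi s t * (psi s t - psi s s) by ring.
have -> : e = e / 2 / B * B + B * (e / 2 / B).
  by rewrite [B * _]mulrC divfK ?gt_eqF// -splitr.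
apply: bndD; apply: bndM; [exact: b1| |exact: bnd_le (hr s t)|exact: b2].
exact: bnd_le (hr' s s).
Qed.

Lemma tame_sum I (r : seq I) (phi : I -> R -> R -> A) :
  (forall i, tame (phi i)) -> tame (fun s t => \sum_(i <- r) phi i s t).
Proof.
move=> phiE; elim: r => [|i r IH].
  by under eq_fun do under eq_fun do rewrite big_nil; exact: tame_cst.
by under eq_fun do under eq_fun do rewrite big_cons; exact: tameD.
Qed.

Lemma tame_prod I (r : seq I) (phi : I -> R -> R -> A) :
  (forall i, tame (phi i)) -> tame (fun s t => \prod_(i <- r) phi i s t).
Proof.
move=> phiE; elim: r => [|i r IH].
  by under eq_fun do under eq_fun do rewrite big_nil; exact: tame_cst.
by under eq_fun do under eq_fun do rewrite big_cons; exact: tameM.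
Qed.

Lemma tame_det n (Phi : R -> R -> 'M[A]_n) :
  (forall i j, tame (fun s t => Phi s t i j)) -> tame (fun s t => \det (Phi s t)).
Proof.
move=> PhiE; apply: tame_sum => s; apply: tameM; first exact: tame_cst.
by apply: tame_prod.
Qed.

(** On the diagonal every trailing block is the identity, of determinant 1. Determinants of tame
    entries are tame, so near the diagonal each minor is within 1/3 of 1, hence invertible by
    [bnd_inv]; only finitely many sizes have to be intersected. *)
Lemma tame_trailing n (Phi : R -> R -> 'M[A]_n) :
  (forall i j, tame (fun s t => Phi s t i j)) -> (forall s, Phi s s = 1%:M) ->
  \forall d \near 0^'+, forall s t, `|s - t| <= d -> trailing_minors_unit (Phi s t).
Proof.
elim: n Phi => [|n IH] Phi PhiE Phi1; first exact: nearW.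
pose Psi s t := @drsubmx _ 1 n 1 n (Phi s t).
have PsiE i j : tame (fun s t => Psi s t i j).
  by rewrite /Psi; under eq_fun do under eq_fun do rewrite !mxE; exact: PhiE.
have Psi1 s : Psi s s = 1%:M by rewrite /Psi Phi1 (scalar_mx_block 1 n) block_mxKdr.
have i3 : (0 : R) < 3^-1 by rewrite invr_gt0.
have [_ /(_ _ i3)] := tame_det PsiE.
apply: filterS2 (IH _ PsiE Psi1) => d b1 b2 s t st; split; last exact: b1.
by apply: bnd_inv; have := b2 s t st; rewrite Psi1 det1.
Qed.

(* The matrices [M_t = h t M] join [M_0], which has entries in the field [F],
   to [M_1 = M], and consecutive terms of a fine subdivision differ by a factor
   [\adj M_s *m M_t] close to the identity. *)
Lemma special_linear_homotopy n : special_linear A n = elementary_group A n.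
Proof.
apply/seteqP; split=> M; last exact: elementary_group_det.
rewrite /special_linear /= => dM.
pose N t := map_mx (h t) M.
have dN t : \det (N t) = 1 by rewrite det_map_mx dM rmorph1.
pose Phi s t := map_mx (h s) (\adj M) *m N t.
have PhiE i j : tame (fun s t => Phi s t i j).
  under eq_fun do under eq_fun do rewrite !mxE.
  apply: tame_sum => k; under eq_fun do under eq_fun do rewrite !mxE.
  apply: tameM; [exact: tame_left|exact: tame_right].
have Phi1 s : Phi s s = 1%:M by rewrite /Phi map_mx_adj mul_adj_mx dN.
have : \forall d \near 0^'+, 0 < d /\
    forall s t, `|s - t| <= d -> trailing_minors_unit (Phi s t).
  by apply: filterS2 (nbhs_right_gt 0) (tame_trailing PhiE Phi1).
move=> /filter_ex[d [d0 hd]].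
have [k] := ltr_add_invr d0; rewrite add0r => kd.
have E0 : elementary_group A n (N 0).
  have -> : N 0 = map_mx iota (map_mx ev M).
    by apply/matrixP => i j; rewrite !mxE h0.
  (* The factorization found over the field is carried to [A] by [iota], which maps elementary
     matrices to elementary matrices. *)
  have /elementary_groupP[s sE ->] : elementary_group F n (map_mx ev M).
    by apply: special_linear_field; rewrite det_map_mx dM rmorph1.
  elim: s sE => [|X s IH] sE.
    by rewrite big_nil map_scalar_mx rmorph1; exact: elementary_group1.
  rewrite big_cons -mulmxE map_mxM; apply: elementary_groupM; last first.
    by apply: IH => Y Ys; apply: sE; rewrite inE Ys orbT.
  have [i [j [a [ij ->]]]] := sE X (mem_head _ _).
  rewrite /elementary_mx map_mxD map_scalar_mx rmorph1 map_mxZ map_delta_mx.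
  exact: elementary_group_mx.
have EN m : elementary_group A n (N (m%:R / k.+1%:R)).
  elim: m => [|m IH]; first by rewrite mul0r.
  pose s : R := m%:R / k.+1%:R; pose t : R := m.+1%:R / k.+1%:R.
  have -> : N t = N s *m Phi s t.
    by rewrite /Phi map_mx_adj mulmxA mul_mx_adj dN mul1mx.
  apply: elementary_groupM => //; apply: elementary_group_trailing; last first.
    by rewrite det_mulmx dN mulr1 det_map_mx; have := congr1 determinant (mul_mx_adj M);
      rewrite det_mulmx dM mul1r det1 => ->; rewrite rmorph1.
  apply: hd; rewrite -mulrBl -natr1 opprD addrA subrr add0r mulN1r normrN.
  by rewrite ger0_norm ?invr_ge0// ltW.
have -> : M = N (k.+1%:R / k.+1%:R); last exact: EN.
by rewrite divff// /N; apply/matrixP => i j; rewrite mxE h1.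
Qed.

End Homotopy.

(** * Algebras of functions on a set contracted to a point *)

Section FunctionAlgebra.
Variables (R : realType) (X : Type) (A : comPzRingType).
Variable v : {rmorphism A -> (X -> R[i])}.
Hypothesis v_inj : injective v.

Variable bnd : R -> (X -> R[i]) -> Prop.
Hypothesis bnd_le : forall r s f, r <= s -> bnd r f -> bnd s f.
Hypothesis bnd0 : bnd 0 0.
Hypothesis bndD : forall r s f g, bnd r f -> bnd s g -> bnd (r + s) (f + g).
Hypothesis bndM : forall r s f g, bnd r f -> bnd s g -> bnd (r * s) (f * g).
Hypothesis bnd_inv : forall a, bnd 3^-1 (v a - 1) -> exists b, v a * v b = 1.

Variables (c : R -> X -> X) (x0 : X).
Hypothesis c1 : c 1 =1 id.
Hypothesis c0 : forall x, c 0 x = x0.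
Hypothesis v_cst : forall k, exists a, v a = cst k.
Hypothesis v_comp : forall a t, exists b, v b = v a \o c t.
Hypothesis comp_bnd : forall a, exists r, forall t, bnd r (v a \o c t).
Hypothesis comp_unif : forall a e, 0 < e ->
  \forall d \near 0^'+, forall s t, `|s - t| <= d ->
    bnd e ((v a \o c s) - (v a \o c t)).

Lemma special_linear_contraction n : special_linear A n = elementary_group A n.
Proof.
(* Injectivity of [v] makes the chosen preimage unique, so the ring laws for [h t] reduce to
   pointwise ones for functions. *)
pose h t a := sval (cid (v_comp a t)).
have hE t a : v (h t a) = v a \o c t by rewrite /h; case: cid.
have hB t : zmod_morphism (h t).
  by move=> a b; apply: v_inj; rewrite rmorphB !hE rmorphB.
have hM t : monoid_morphism (h t).
  split=> [|a b]; apply: v_inj; first by rewrite hE !rmorph1.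
  by rewrite rmorphM !hE rmorphM.
pose H t : {rmorphism A -> A} := HB.pack (h t)
  (GRing.isZmodMorphism.Build _ _ (h t) (hB t))
  (GRing.isMonoidMorphism.Build _ _ (h t) (hM t)).
pose iota k := sval (cid (v_cst k)).
have iotaE k : v (iota k) = cst k by rewrite /iota; case: cid.
have iotaB : zmod_morphism iota.
  by move=> a b; apply: v_inj; rewrite rmorphB !iotaE.
have iotaM : monoid_morphism iota.
  split=> [|a b]; apply: v_inj; first by rewrite iotaE !rmorph1.
  by rewrite rmorphM !iotaE.
pose I : {rmorphism R[i] -> A} := HB.pack iota
  (GRing.isZmodMorphism.Build _ _ iota iotaB)
  (GRing.isMonoidMorphism.Build _ _ iota iotaM).
pose ev a := v a x0.
have evB : zmod_morphism ev by move=> a b; rewrite /ev rmorphB.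
have evM : monoid_morphism ev.
  by split=> [|a b]; rewrite /ev ?rmorph1 ?rmorphM.
pose E : {rmorphism A -> R[i]} := HB.pack ev
  (GRing.isZmodMorphism.Build _ _ ev evB)
  (GRing.isMonoidMorphism.Build _ _ ev evM).
apply: (@special_linear_homotopy _ _ (fun r a => bnd r (v a)) _ _ _ _ _ H _ _ _ _ I E).
- by move=> r s a; exact: bnd_le.
- by rewrite rmorph0; exact: bnd0.
- by move=> r s a b ba bb; rewrite rmorphD; exact: bndD.
- by move=> r s a b ba bb; rewrite rmorphM; exact: bndM.
- move=> a; rewrite rmorphB rmorph1 => /bnd_inv[b ab]; exists b.
  by apply: v_inj; rewrite rmorphM ab rmorph1.
- by move=> a; have [r hr] := comp_bnd a; exists r => t; rewrite /= hE.
- move=> a e /(comp_unif a); apply: filterS => d hd s t st.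
  by rewrite rmorphB !hE; exact: hd.
- by move=> a; apply: v_inj; rewrite /= hE; apply/funext => x /=; rewrite c1.
- by move=> a; apply: v_inj; rewrite /= hE iotaE; apply/funext => x /=; rewrite c0.
Qed.

End FunctionAlgebra.

(** * Algebras of continuous holomorphic functions *)

Section Modulus.
Variable R : realType.
Local Notation C := R[i].
Local Notation normc := Normc.normc.

(** The norm of [R[i]] takes its values in [R[i]]; real estimates go through [normc]. *)
Lemma normc_real (x : C) : `|x| = (normc x)%:C%C. Proof. by []. Qed.

Lemma normc_ge0 (x : C) : 0 <= normc x.
Proof. by rewrite -lecR -normc_real normr_ge0. Qed.

Lemma normc_dist (x y : C) : normc x <= normc y + normc (y - x).
Proof. by rewrite -[normc (y - x)]normcN -{1}(subrKC y x) opprB le_normcD. Qed.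

End Modulus.

(** * Dilations of a set star-shaped about the origin *)

Section Dilation.
Variables (R : realType) (d : nat) (K : set 'rV[R[i]]_d).
Hypothesis K_star : forall (t : R) z, 0 <= t <= 1 -> K z -> K (t%:C%C *: z).

Definition clamp (t : R) : R := Num.max 0 (Num.min 1 t).

Lemma clamp_itv t : 0 <= clamp t <= 1.
Proof. by rewrite /clamp le_max lexx ge_max ler01 ge_min lexx. Qed.

Lemma clamp0 : clamp 0 = 0.
Proof. by rewrite /clamp min_r ?maxxx. Qed.

Lemma clamp1 : clamp 1 = 1.
Proof. by rewrite /clamp minxx max_r. Qed.

Lemma clamp_dist s t : `|clamp s - clamp t| <= `|s - t|.
Proof.
rewrite /clamp; case: (leP 1 s) => hs; case: (leP 1 t) => ht.
- by rewrite subrr normr0 normr_ge0.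
- rewrite (max_r ler01); case: (leP 0 t) => h0; rewrite !ger0_norm; lra.
- rewrite (max_r ler01); case: (leP 0 s) => h0; rewrite !ler0_norm; lra.
- case: (leP 0 s) => h0; case: (leP 0 t) => h1 //.
  + by rewrite !ger0_norm; lra.
  + by rewrite !ler0_norm; lra.
  + by rewrite subrr normr0 normr_ge0.
Qed.

(* Clamping [t] to [0, 1] makes the dilation a self-map of [K] for every [t]. *)
Definition dilation (t : R) (z : K) : K :=
  SigSub (mem_set (K_star (clamp_itv t) (set_valP z))).

Lemma dilationE t z : set_val (dilation t z) = (clamp t)%:C%C *: set_val z.
Proof. by []. Qed.

Lemma dilation1 : dilation 1 =1 id.
Proof. by move=> z; apply: val_inj; rewrite /= clamp1 scale1r. Qed.

Lemma dilation0 (K0 : K 0) z : dilation 0 z = SigSub (mem_set K0).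
Proof. by apply: val_inj; rewrite /= clamp0 scale0r. Qed.

Lemma dilation_continuous t : continuous (dilation t).
Proof.
apply: continuous_comp_initial.
rewrite (_ : _ \o _ = *:%R (clamp t)%:C%C \o set_val)// => z.
apply: continuous_comp; first exact: initial_continuous.
exact: scaler_continuous.
Qed.

End Dilation.

(** * Continuous holomorphic functions on a compact star-shaped set *)

Section ContinuousHolomorphic.
Variables (R : realType) (d : nat) (K U : set 'rV[R[i]]_d).
Local Notation C := R[i].
Local Notation normc := Normc.normc.
Hypothesis K_star : forall (t : R) z, 0 <= t <= 1 -> K z -> K (t%:C%C *: z).
Hypothesis U_star : forall (t : R) z, 0 <= t <= 1 -> U z -> U (t%:C%C *: z).
Hypothesis U_open : open U.
Hypothesis UK : U `<=` K.
Hypothesis K_compact : compact K.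
Hypothesis K_bounded : forall z, K z -> `|z| <= 1.
Hypothesis K0 : K 0.

Lemma holomorphic_cst k : cst k \in continuous_holomorphic K U.
Proof.
rewrite inE; split; first by move=> x; exact: cst_continuous.
move=> z Uz; apply: (@differentiable_near _ _ (cst k)); last exact: differentiable_cst.
have : \forall w \near z, U w by exact: open_nbhs_nbhs.
by apply: filterS => w /UK/mem_set wK; rewrite (valL0E _ wK).
Qed.

Lemma holomorphic_dilation f t : f \in continuous_holomorphic K U ->
  f \o dilation K_star t \in continuous_holomorphic K U.
Proof.
rewrite !inE => -[cf df]; split.
  by move=> z; apply: continuous_comp; [exact: dilation_continuous|exact: cf].
move=> z Uz.
(* Outside [K] the two extensions may differ; they agree on the open set [U], which determines the
   derivative at [z]. *)
apply: (@differentiable_near _ _ (valL_ 0 f \o *:%R (clamp t)%:C%C)).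
  have : \forall w \near z, U w by exact: open_nbhs_nbhs.
  apply: filterS => w /UK Kw; rewrite (valL0E _ (mem_set Kw)) [LHS]/comp.
  have Ktw := K_star (clamp_itv t) Kw.
  by rewrite (valL0E _ (mem_set Ktw)); congr f; exact: val_inj.
apply: differentiable_comp; last by apply: df; apply: U_star (clamp_itv t) Uz.
by apply: linear_differentiable; exact: scaler_continuous.
Qed.

Lemma holomorphic_inv f : f \in continuous_holomorphic K U ->
  (forall z, f z != 0) -> (fun z => (f z)^-1) \in continuous_holomorphic K U.
Proof.
rewrite !inE => -[cf df] f0; split.
  by move=> z; apply: (@continuous_comp _ _ _ f GRing.inv z (cf z)); exact: inv_continuous.
(* As [0^-1 = 0], extension by 0 commutes with inversion outside [K] too. *)
move=> z Uz; rewrite (_ : valL_ 0 _ = fun w => (valL_ 0 f w)^-1).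
  by apply: differentiableV; [exact: df|rewrite (valL0E _ (mem_set (UK Uz)))].
apply/funext => w; have [wK|wK] := boolP (w \in K); first by rewrite !(valL0E _ wK).
by rewrite !(valL0N _ wK) invr0.
Qed.

(** The extension [valL_ 0 f] lets points range over row vectors, where [K] is compact. The radius
    of a ball there is a positive element of [R[i]], hence real. *)
Lemma continuous_delta (f : K -> C) (e : R) x : continuous f -> 0 < e -> K x ->
  exists2 dl : R, 0 < dl & forall y, K y -> `|x - y| < dl%:C%C ->
    normc (valL_ 0 f x - valL_ 0 f y) < e.
Proof.
move=> /(@subspace_valL_continuousP' _ K C 0 f) cf e0 Kx.
have e0' : 0 < e%:C%C :> C by rewrite ltcR.
have /cvgrPdist_lt/(_ _ e0') := cf x.
move=> /(nbhs_subspace_ex _ Kx)[V /nbhs_ballP[dl dl0 hdl] UV].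
have dlE : dl = (complex.Re dl)%:C%C by rewrite RRe_real// gtr0_real.
exists (complex.Re dl); first by rewrite -ltcR -dlE.
rewrite -dlE => y Ky xy; rewrite -ltcR -normc_real.
have : (V `&` K) y by split=> //; apply: hdl; rewrite -ball_normE.
by rewrite -UV => -[].
Qed.

Lemma valL_set_val (f : K -> C) z : valL_ 0 f (set_val z) = f z.
Proof. by rewrite (valL0E _ (valP z)); congr f; exact: val_inj. Qed.

(** Compactness is used as a near-covering property: a bound that holds around each point for all
    large [r] holds on all of [K] for all large [r]. *)
Lemma continuous_on_compact_bounded (f : K -> C) : continuous f ->
  exists r, forall z, normc (f z) <= r.
Proof.
move=> cf; pose P r z := K z -> normc (valL_ 0 f z) <= r.
have /filter_ex[r hr] : \forall r \near +oo%R, K `<=` P r.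
  apply: ((compact_near_coveringP K).1 K_compact) => x Kx.
  have [dl dl0 hdl] := continuous_delta cf ltr01 Kx.
  exists (ball x dl%:C%C, [set r : R | normc (valL_ 0 f x) + 1 < r]) => /=.
    by split; [apply: nbhsx_ballx; rewrite ltcR|apply: nbhs_pinfty_gt; exact: num_real].
  move=> [z r] [/= zx hr] Kz; move: zx; rewrite -ball_normE /= => /(hdl _ Kz) zx.
  by apply: le_trans (normc_dist _ (valL_ 0 f x)) _; lra.
by exists r => z; rewrite -valL_set_val; apply: hr; exact: set_valP.
Qed.

Lemma continuous_on_compact_unif (f : K -> C) (e : R) : continuous f -> 0 < e ->
  \forall d \near 0^'+, forall z w, `|set_val z - set_val w| <= d%:C%C ->
    normc (f z - f w) <= e.
Proof.
move=> cf e0; pose P d z := K z -> forall w, K w -> `|z - w| <= d%:C%C ->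
  normc (valL_ 0 f z - valL_ 0 f w) <= e.
have : \forall d \near 0^'+, K `<=` P d.
  apply: ((compact_near_coveringP K).1 K_compact) => x Kx.
  have e20 : 0 < e / 2 by rewrite divr_gt0.
  have [dl dl0 hdl] := continuous_delta cf e20 Kx.
  (* With [z] within [dl / 2] of [x] and [w] within [dl / 2] of [z], both are within [dl] of [x]. *)
  exists (ball x (dl / 2)%:C%C, [set d : R | d < dl / 2]) => /=.
    split; first by apply: nbhsx_ballx; rewrite ltcR divr_gt0.
    by apply: nbhs_right_lt; rewrite divr_gt0.
  move=> [z h] [/= zx hd] Kz w Kw zw; move: zx; rewrite -ball_normE /= => zx.
  have xz : `|x - z| < dl%:C%C by apply: lt_trans zx _; rewrite ltcR; lra.
  have xw : `|x - w| < dl%:C%C.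
    rewrite -[x - w](subrKA z) [dl]splitr rmorphD; apply: le_lt_trans (ler_normD _ _) _.
    by apply: ltrD => //; apply: le_lt_trans zw _; rewrite ltcR.
  apply: le_trans (normc_dist _ (valL_ 0 f x - valL_ 0 f w)) _.
  rewrite opprB addrA subrK [leRHS]splitr; apply: lerD; exact/ltW/hdl.
apply: filterS => h hh z w zw; rewrite -!valL_set_val.
by apply: hh => //; exact: set_valP.
Qed.

Variables (A : comPzRingType) (v : {rmorphism A -> (K -> C)}).
Hypothesis v_inj : injective v.
Hypothesis v_range : forall f,
  f \in continuous_holomorphic K U <-> exists a, v a = f.

(** With the sup norm for [bnd]: [K] lies in the unit ball of the maximum norm, so the dilations of
    parameters [s] and [t] differ by at most [|s - t|] at each point, and uniform continuity of a
    function on [K] gives that of its dilates. *)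
Lemma special_linear_holomorphic n : special_linear A n = elementary_group A n.
Proof.
pose bnd (r : R) (f : K -> C) := forall z, normc (f z) <= r.
have vch a : v a \in continuous_holomorphic K U by apply/v_range; exists a.
apply: (@special_linear_contraction R K A v v_inj bnd _ _ _ _ _
  (dilation K_star) (SigSub (mem_set K0))).
- by move=> r s f rs hf z; apply: le_trans (hf z) rs.
- by move=> z; rewrite Normc.normc0.
- by move=> r s f g hf hg z; apply: le_trans (le_normcD _ _) (lerD (hf z) (hg z)).
- move=> r s f g hf hg z; rewrite [_ z](_ : _ = f z * g z)// Normc.normcM.
  by apply: ler_pM => //; rewrite -lecR -normc_real normr_ge0.
- move=> a ha; have f0 z : v a z != 0.
    apply/eqP => az0; have := ha z; rewrite [X in normc X](_ : _ = v a z - 1)// az0.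
    by rewrite sub0r normcN Normc.normc1; lra.
  have [b vb] := (v_range _).1 (holomorphic_inv (vch a) f0).
  by exists b; rewrite vb; apply/funext => z; exact: divff.
- exact: dilation1.
- exact: dilation0.
- by move=> k; apply/v_range; exact: holomorphic_cst.
- by move=> a t; apply/v_range; exact: holomorphic_dilation.
- move=> a; have := vch a; rewrite inE => -[ca _].
  have [r hr] := continuous_on_compact_bounded ca.
  by exists r => t z; exact: hr.
- move=> a e e0; have := vch a; rewrite inE => -[ca _].
  apply: filterS (continuous_on_compact_unif ca e0) => h hh s t st z.
  apply: hh; rewrite !dilationE -scalerBl normrZ -rmorphB normc_real.
  apply: (@le_trans _ _ ((normc (clamp s - clamp t)%:C%C)%:C%C)).
    by rewrite ler_piMr ?K_bounded//; [rewrite ler0c normc_ge0|exact: set_valP].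
  rewrite lecR; apply: le_trans st; apply: le_trans (clamp_dist s t).
  by rewrite /= expr0n addr0 sqrtr_sqr.
Qed.

End ContinuousHolomorphic.

(** * The polydisc and the ball *)

Section PolydiscBall.
Variable R : realType.
Local Notation C := R[i].

Lemma Re_continuous : continuous (fun z : C => complex.Re z).
Proof.
move=> z; apply/(@cvgrPdist_lt _ _ _ _ (nbhs_filter z)) => e e0.
have e0' : 0 < e%:C%C :> C by rewrite ltcR.
apply: filterS (nbhsx_ballx z _ e0') => w; rewrite -ball_normE /= => zw.
by rewrite -ltcR -raddfB; apply: le_lt_trans (normc_ge_Re _) zw.
Qed.

Lemma real_complex_continuous : continuous (fun x : R => x%:C%C).
Proof.
move=> x; apply/cvgrPdist_lt => e e0.
have eE : e = (complex.Re e)%:C%C by rewrite RRe_real// gtr0_real.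
have e0' : 0 < complex.Re e by rewrite -ltcR -eE.
apply: filterS (nbhsx_ballx x _ e0') => y; rewrite -ball_normE /= => xy.
by rewrite eE -rmorphB normc_def /= expr0n addr0 sqrtr_sqr ltcR.
Qed.

Lemma Re_le1 (x : C) : 0 <= x -> (complex.Re x <= 1) = (x <= 1).
Proof. by move=> x0; rewrite -lecR RRe_real// ger0_real. Qed.

Lemma compact_unit_disc : compact [set z : C | `|z| <= 1].
Proof.
pose f (p : R * R) : C := p.1%:C%C + 'i%C * p.2%:C%C.
have cf : continuous f.
  move=> p; apply: cvgD.
    by apply: (continuous_comp (@cvg_fst _ _ _ _ _)); exact: real_complex_continuous.
  apply: cvgMr; apply: (continuous_comp (@cvg_snd _ _ _ _ _)).
  exact: real_complex_continuous.
pose Q := `[-1, 1]%classic `*` `[-1, 1]%classic : set (R * R).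
have cQ : compact (f @` Q).
  apply: continuous_compact; first exact: continuous_subspaceT.
  by apply: compact_setX; exact: segment_compact.
apply: (subclosed_compact _ cQ).
  (* Closedness is pulled back from a real half-line, [|z|] being a real element of [R[i]]. *)
  have -> : [set z : C | `|z| <= 1] = (fun z => complex.Re `|z|) @^-1` [set x | x <= 1].
    apply/funext => z; exact/esym/(congr1 is_true (Re_le1 (normr_ge0 z))).
  apply: preimage_closed (@closed_le _ 1) => z _.
  apply: (@continuous_comp _ _ _ (fun z : C => `|z| : C) (fun w : C => complex.Re w)).
    exact: (@norm_continuous _ C).
  exact: Re_continuous.
move=> z /= z1; exists (complex.Re z, complex.Im z); last by rewrite /f -complexE.
have zRe := le_trans (normc_ge_Re z) z1.
have zIm : `|complex.Im z|%:C%C <= 1 :> C.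
  apply: le_trans z1; rewrite -[complex.Im z]opprK -ReiNIm normrN.
  apply: le_trans (normc_ge_Re _) _; rewrite normrM [X in _ * X]normc_def /=.
  by rewrite expr0n expr1n add0r sqrtr1 mulr1.
rewrite lecR ler_norml in zRe; rewrite lecR ler_norml in zIm.
by split; rewrite /= in_itv.
Qed.

Variable d : nat.

Lemma compact_closed_polydisc : compact (closed_polydisc R d).
Proof.
exact: (@rV_compact _ d (fun=> [set z : C | `|z| <= 1]) (fun=> compact_unit_disc)).
Qed.

Lemma closed_ball_sub_polydisc : Defs.closed_ball R d `<=` closed_polydisc R d.
Proof.
move=> z /= z1 i; rewrite -(@expr_le1 _ 2)//.
by apply: le_trans z1; rewrite (bigD1 i)//= lerDl sumr_ge0.
Qed.

Lemma compact_closed_ball : compact (Defs.closed_ball R d).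
Proof.
apply: subclosed_compact compact_closed_polydisc closed_ball_sub_polydisc.
pose q (z : 'rV[C]_d) : C := \sum_i `|z ord0 i| ^+ 2.
have -> : Defs.closed_ball R d = (fun z => complex.Re (q z)) @^-1` [set x | x <= 1].
  apply/funext => z; apply/esym/(congr1 is_true)/Re_le1.
  by rewrite sumr_ge0// => i _; rewrite exprn_ge0.
apply: preimage_closed (@closed_le _ 1) => z _.
apply: (@continuous_comp _ _ _ q (fun w : C => complex.Re w)); last exact: Re_continuous.
apply: continuous_big => [|i _ w]; first exact: add_continuous.
apply: (@continuousM _ _ (fun w : 'rV[C]_d => `|w ord0 i|));
  exact/(continuous_comp (@coord_continuous _ _ _ _ _ _) (@norm_continuous _ _ _)).
Qed.

Lemma normr_closed_polydisc (z : 'rV[C]_d) : closed_polydisc R d z -> `|z| <= 1.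
Proof.
move=> z1; rewrite -[`|z|]/(mx_norm z).
have [->|/mx_norm_neq0[[i j] ->]] := eqVneq (mx_norm z) 0; first exact: ler01.
by rewrite ord1; exact: z1.
Qed.

Lemma closed_polydisc0 : closed_polydisc R d 0.
Proof. by move=> i; rewrite mxE normr0 ler01. Qed.

Lemma closed_ball0 : Defs.closed_ball R d 0.
Proof. by rewrite /Defs.closed_ball /= big1 ?ler01// => i _; rewrite mxE normr0 expr0n. Qed.

Lemma normr_scale_le (t : R) (x : C) : 0 <= t <= 1 -> `|t%:C%C * x| <= `|x|.
Proof.
move=> /andP[t0 t1]; rewrite normrM ler_piMl// ger0_norm ?ler0c//.
by rewrite -lecR in t1.
Qed.

Lemma closed_polydisc_star (t : R) z : 0 <= t <= 1 ->
  closed_polydisc R d z -> closed_polydisc R d (t%:C%C *: z).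
Proof. by move=> t01 z1 i; rewrite mxE; exact: le_trans (normr_scale_le _ t01) (z1 i). Qed.

Lemma open_polydisc_star (t : R) z : 0 <= t <= 1 ->
  open_polydisc R d z -> open_polydisc R d (t%:C%C *: z).
Proof. by move=> t01 z1 i; rewrite mxE; exact: le_lt_trans (normr_scale_le _ t01) (z1 i). Qed.

Lemma sqr_sum_scale_le (t : R) (z : 'rV[C]_d) : 0 <= t <= 1 ->
  \sum_i `|(t%:C%C *: z) ord0 i| ^+ 2 <= \sum_i `|z ord0 i| ^+ 2.
Proof.
move=> t01; apply: ler_sum => i _; rewrite mxE lerXn2r ?nnegrE//.
exact: normr_scale_le.
Qed.

Lemma closed_ball_star (t : R) z : 0 <= t <= 1 ->
  Defs.closed_ball R d z -> Defs.closed_ball R d (t%:C%C *: z).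
Proof. by move=> t01; exact: le_trans (sqr_sum_scale_le _ t01). Qed.

Lemma open_ball_star (t : R) z : 0 <= t <= 1 ->
  open_ball R d z -> open_ball R d (t%:C%C *: z).
Proof. by move=> t01; exact: le_lt_trans (sqr_sum_scale_le _ t01). Qed.

Lemma special_linear_polydisc n :
  special_linear (polydisc_algebra R d) n = elementary_group (polydisc_algebra R d) n.
Proof.
apply: (@special_linear_holomorphic R d _ (open_polydisc R d) closed_polydisc_star
  open_polydisc_star (@open_open_polydisc R d) (@open_polydisc_sub R d)
  compact_closed_polydisc normr_closed_polydisc closed_polydisc0 _ val val_inj) => f.
split=> [fP|[a <-]]; last exact: valP.
by exists (PolydiscAlgebra fP).
Qed.

Lemma special_linear_ball n :
  special_linear (ball_algebra R d) n = elementary_group (ball_algebra R d) n.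
Proof.
apply: (@special_linear_holomorphic R d _ (open_ball R d) closed_ball_star
  open_ball_star (@open_open_ball R d) (@open_ball_sub R d)
  compact_closed_ball _ closed_ball0 _ val val_inj) => [z zB|f].
  exact/normr_closed_polydisc/closed_ball_sub_polydisc.
split=> [fP|[a <-]]; last exact: valP.
by exists (BallAlgebra fP).
Qed.

End PolydiscBall.

(** * The Wiener algebra *)

Section Convolution.
Variable d : nat.
Local Notation mi := (multi_index d).
Local Notation cube := (@multi_cube d).
Implicit Types (k l m : mi) (N : nat).

Definition mi_add k l : mi := [ffun i => (k i + l i)%N].
Definition mi_deg k : nat := \sum_i k i.
Definition mi0 : mi := [ffun=> 0%N].

Lemma mi_deg_add k l : mi_deg (mi_add k l) = (mi_deg k + mi_deg l)%N.
Proof. by rewrite -big_split; apply: eq_bigr => i _; rewrite ffunE. Qed.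

Lemma mi_deg_eq0 k : (mi_deg k == 0)%N = (k == mi0).
Proof.
rewrite sum_nat_eq0; apply/forallP/eqP => [k0|-> i]; last by rewrite ffunE.
by apply/ffunP => i; rewrite ffunE; exact/eqP/k0.
Qed.

Lemma mi_deg_cube N k : cube N k -> (mi_deg k <= d * N)%N.
Proof.
move=> kN; rewrite -[d in leqRHS]card_ord -sum_nat_const.
by apply: leq_sum => i _; exact/ltnW/kN.
Qed.

Definition mi_conv (F : idomainType) (u v : mi -> F) k :=
  \sum_(p \in [set p | mi_add p.1 p.2 = k]) u p.1 * v p.2.

Definition square N := cube N `*` cube N.
(** The pairs that contribute to a coefficient of the Cauchy product in the cube of side [N]. They
    lie between the squares of sides [N./2] and [N]. *)
Definition triangle N := [set p : mi * mi | cube N (mi_add p.1 p.2)].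

Lemma finite_square N : finite_set (square N).
Proof. by apply: finite_setX; exact: finite_multi_cube. Qed.

Lemma triangle_square N : triangle N `<=` square N.
Proof.
move=> p pN; split=> i; apply: leq_ltn_trans (pN i); rewrite ffunE.
  exact: leq_addr.
exact: leq_addl.
Qed.

Lemma half_square_triangle N : square N./2 `<=` triangle N.
Proof.
move=> p [p1 p2] i; rewrite ffunE; have := p1 i; have := p2 i.
by move: (odd_double_half N); lia.
Qed.

Lemma finite_mi_add k : finite_set [set p : mi * mi | mi_add p.1 p.2 = k].
Proof.
have [N kN] := finite_sub_cube (finite_set1 k).
apply: sub_finite_set (finite_square N) => p pk.
by apply: triangle_square; apply: kN.
Qed.

Section Idomain.
Variable F : idomainType.
Implicit Types u v : mi -> F.

Lemma sum_mul_square u v N :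
  (\sum_(k \in cube N) u k) * (\sum_(k \in cube N) v k) =
  \sum_(p \in square N) u p.1 * v p.2.
Proof.
rewrite mulr_fsuml -(@pair_fsbig _ _ _ _ _ _ _ (fun k l => u k * v l)).
- by apply: eq_fsbigr => k _; rewrite mulr_fsumr.
- exact: finite_multi_cube.
- exact: finite_multi_cube.
Qed.

(** Each pair lies over exactly one index, its sum, so exchanging the two finite sums of [G] counts
    every pair of the triangle once. *)
Lemma sum_conv u v N :
  \sum_(k \in cube N) mi_conv u v k =
  \sum_(p \in square N `&` triangle N) u p.1 * v p.2.
Proof.
pose G k (p : mi * mi) := if mi_add p.1 p.2 == k then u p.1 * v p.2 else 0.
transitivity (\sum_(k \in cube N) \sum_(p \in square N) G k p).
  apply: eq_fsbigr => k /set_mem kN; rewrite -(@fsbig_widen _ _ _ _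
    [set p | mi_add p.1 p.2 = k]).
  - by apply: eq_fsbigr => p /set_mem /= pk; rewrite /G pk eqxx.
  - by move=> p /= pk; apply: triangle_square; rewrite /triangle /= pk.
  - by move=> p [_ /= /eqP/negbTE]; rewrite /G => ->.
rewrite exchange_fsbig; [|exact: finite_multi_cube|exact: finite_square].
rewrite [RHS](@fsbig_mkcondr _ _ _ _ (square N) (triangle N));
apply: eq_fsbigr => p _; case: ifPn => [/set_mem pN|/negP pN].
  rewrite -(@fsbig_widen _ _ _ _ [set mi_add p.1 p.2]).
  - by rewrite fsbig_set1 /G eqxx.
  - by move=> k ->.
  - by move=> k [_ /=] /eqP; rewrite /G eq_sym => /negbTE ->.
apply: fsbig1 => k kN; rewrite /G; case: eqP => // pk.
by case: pN; rewrite inE /triangle /= pk.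
Qed.

Lemma sum_mul_sub_conv u v N :
  (\sum_(k \in cube N) u k) * (\sum_(k \in cube N) v k) -
    \sum_(k \in cube N) mi_conv u v k =
  \sum_(p \in square N `&` ~` triangle N) u p.1 * v p.2.
Proof.
rewrite sum_mul_square sum_conv (fsbigID (triangle N) (square N)) /=.
  by rewrite addrAC subrr add0r.
exact: finite_square.
Qed.

(** A term with [p.1 = 0] vanishes and any other [p.2] has smaller degree than [k]. Thus
    [b = 1 + u b] is a recursion on the degree. *)
Lemma conv_local u v w k : u mi0 = 0 ->
  (forall m, (mi_deg m < mi_deg k)%N -> v m = w m) -> mi_conv u v k = mi_conv u w k.
Proof.
move=> u0 vw; apply: eq_fsbigr => p /set_mem /= pk.
have [->|p10] := eqVneq p.1 mi0; first by rewrite u0 !mul0r.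
by rewrite vw// -pk mi_deg_add -[ltnLHS]add0n ltn_add2r lt0n mi_deg_eq0.
Qed.

(** The partial sum [1 + u + ... + u^(j-1)] of the formal geometric series. *)
Fixpoint conv_iter u j : mi -> F :=
  if j is i.+1 then fun k => (k == mi0)%:R + mi_conv u (conv_iter u i) k
  else fun=> 0.

Lemma conv_iter_stable u i j k : u mi0 = 0 ->
  (mi_deg k < i)%N -> (mi_deg k < j)%N -> conv_iter u i k = conv_iter u j k.
Proof.
move=> u0; elim: i j k => // i IH [//|j] k ki kj /=; congr (_ + _).
by apply: conv_local => // m mk; apply: IH; apply: leq_trans mk _.
Qed.

(** The coefficient of degree m is constant from iterate m + 1 on; these stable values form the
    formal series [(1 - u)^-1]. *)
Lemma conv_fixpoint u : u mi0 = 0 ->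
  exists b : mi -> F, forall k, b k = (k == mi0)%:R + mi_conv u b k.
Proof.
move=> u0; exists (fun k => conv_iter u (mi_deg k).+1 k) => k /=; congr (_ + _).
by apply: conv_local => // m mk; exact: (@conv_iter_stable u _ (mi_deg m).+1).
Qed.

(** The side is [N.+1] because the cube of side 0 is empty for positive [d]. *)
Lemma sum_delta N : \sum_(k \in cube N.+1) ((k == mi0)%:R : F) = 1.
Proof.
rewrite -(@fsbig_widen _ _ _ _ [set mi0]) ?fsbig_set1 ?eqxx//.
  by move=> _ -> i; rewrite ffunE.
by move=> k [_ /= /eqP/negbTE ->].
Qed.

End Idomain.

Section Complex.
Variable R : realType.
Local Notation C := R[i].
Local Notation normc := Normc.normc.
Implicit Types u v : mi -> C.

Definition norm_sum u N := \sum_(k \in cube N) normc (u k).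

Lemma norm_sum_ge0 u N : 0 <= norm_sum u N.
Proof. by apply: fsumr_ge0 => k _; exact: normc_ge0. Qed.

Lemma norm_sum_homo u : {homo norm_sum u : m n / (m <= n)%N >-> m <= n}.
Proof.
move=> m n mn; apply: ler_fsum_subset; first exact: finite_multi_cube.
  exact: multi_cube_sub.
by move=> k _; exact: normc_ge0.
Qed.

(** The l1 norm is submultiplicative already on each cube, since the triangle lies in the square. *)
Lemma norm_sum_conv u v N : norm_sum (mi_conv u v) N <= norm_sum u N * norm_sum v N.
Proof.
apply: (@le_trans _ _ (\sum_(k \in cube N)
    mi_conv (fun k => normc (u k)) (fun k => normc (v k)) k)).
  apply: ler_fsumr => [|k _]; first exact: finite_multi_cube.
  apply: le_trans (normc_fsum _ (finite_mi_add _)) _.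
  by apply: ler_fsumr (finite_mi_add k) _ => p _; rewrite Normc.normcM.
rewrite sum_conv [leRHS]sum_mul_square.
apply: ler_fsum_subset => [||p _]; first exact: finite_square.
  exact: subIsetl.
by rewrite mulr_ge0// normc_ge0.
Qed.

Lemma norm_sum_cvg u r : (forall N, norm_sum u N <= r) -> cvgn (norm_sum u).
Proof.
move=> ur; apply: nondecreasing_is_cvgn; first exact: norm_sum_homo.
by exists r => _ [N _ <-].
Qed.

(** The defect is a sum over the square minus the triangle, hence over pairs outside the square of
    side [N./2]. It is at most the difference of the products of the two norm sums at [N] and at
    [N./2], and these products have the same limit. *)
Lemma cauchy_defect u v r s :
  (forall N, norm_sum u N <= r) -> (forall N, norm_sum v N <= s) ->
  (\sum_(k \in cube N) u k) * (\sum_(k \in cube N) v k) -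
    \sum_(k \in cube N) mi_conv u v k @[N --> \oo] --> (0 : C).
Proof.
move=> ur vs; apply/cvgr0Pnorm_lt => e e0.
have eE : e = (complex.Re e)%:C%C by rewrite RRe_real// gtr0_real.
have e0' : 0 < complex.Re e by rewrite -ltcR -eE.
have cu := norm_sum_cvg ur; have cv := norm_sum_cvg vs.
have D0 : norm_sum u N * norm_sum v N - norm_sum u N./2 * norm_sum v N./2
    @[N --> \oo] --> (0 : R).
  rewrite -(subrr (limn (norm_sum u) * limn (norm_sum v))); apply: cvgB; apply: cvgM => //.
    exact: (cvg_comp _ _ cvg_half cu).
  exact: (cvg_comp _ _ cvg_half cv).
have /(_ _ _ e0') := cvgr_lt _ D0; apply: filterS => N DN.
rewrite eE normc_real ltcR; apply: le_lt_trans DN; rewrite sum_mul_sub_conv.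
have fin : finite_set (square N `&` ~` triangle N).
  by apply: sub_finite_set (finite_square N); exact: subIsetl.
apply: le_trans (normc_fsum _ fin) _; rewrite lerBrDl !sum_mul_square.
rewrite [leRHS](fsbigID (triangle N) (square N)); last exact: finite_square.
rewrite /= -[X in _ + X <= _]/(\sum_(p \in square N `&` ~` triangle N) _).
have nn (p : mi * mi) : 0 <= normc (u p.1) * normc (v p.2).
  by rewrite mulr_ge0// normc_ge0.
apply: lerD.
  apply: ler_fsum_subset => // [|p pN]; last by split;
    [apply: triangle_square|]; exact: half_square_triangle.
  by apply: sub_finite_set (finite_square N); exact: subIsetl.
by apply: ler_fsumr => // p _; rewrite Normc.normcM.
Qed.

End Complex.
End Convolution.

(** * Absolutely convergent power series on the polydisc *)

Section Wiener.
Variables (R : realType) (d : nat).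
Local Notation C := R[i].
Local Notation normc := Normc.normc.
Local Notation mi := (multi_index d).
Local Notation cube := (@multi_cube d).
Local Notation X := (closed_polydisc R d).

Definition psum (a : mi -> C) (z : X) N : C :=
  \sum_(k \in cube N) a k * monomial (set_val z) k.

(** Since some coefficients are asked for, an upper bound on the norm is proved by exhibiting
    them. *)
Definition wiener_bound (r : R) (f : X -> C) := exists2 a : mi -> C,
  forall N, norm_sum a N <= r & forall z, psum a z N @[N --> \oo] --> f z.

Lemma wiener_boundP f : f \in @abs_power_series R d <-> exists r, wiener_bound r f.
Proof.
rewrite inE; split=> [[a [/summableP[r ar] af]]|[r [a ar af]]].
  by exists r, a.
by exists a; split=> //; apply/summableP; exists r.
Qed.

Lemma normc_monomial (z : X) k : normc (monomial (set_val z) k) <= 1.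
Proof.
rewrite -lecR -normc_real normr_prod; apply: prodr_ile1 => i _.
by rewrite normr_ge0 /= normrX exprn_ile1 ?normr_ge0//; exact: (set_valP z).
Qed.

Lemma norm_sum_monomial a (z : X) N :
  norm_sum (fun k => a k * monomial (set_val z) k) N <= norm_sum a N.
Proof.
apply: ler_fsumr => [|k _]; first exact: finite_multi_cube.
by rewrite Normc.normcM ler_piMr ?normc_ge0// normc_monomial.
Qed.

Lemma monomialD (z : 'rV[C]_d) k l :
  monomial z (mi_add k l) = monomial z k * monomial z l.
Proof. by rewrite -big_split; apply: eq_bigr => i _; rewrite ffunE exprD. Qed.

Lemma monomial0 (z : 'rV[C]_d) : monomial z (mi0 d) = 1.
Proof. by apply: big1 => i _; rewrite ffunE expr0. Qed.

Lemma monomialZ t (z : 'rV[C]_d) k :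
  monomial (t *: z) k = t ^+ mi_deg k * monomial z k.
Proof.
rewrite /mi_deg expr_sum -big_split; apply: eq_bigr => i _.
by rewrite mxE exprMn.
Qed.

Lemma conv_monomial a b (z : 'rV[C]_d) k :
  mi_conv (fun k => a k * monomial z k) (fun k => b k * monomial z k) k =
  mi_conv a b k * monomial z k.
Proof.
rewrite /mi_conv mulr_fsuml; apply: eq_fsbigr => p /set_mem /= <-.
by rewrite monomialD mulrACA.
Qed.

Lemma wiener_bound_le r s f : r <= s -> wiener_bound r f -> wiener_bound s f.
Proof. by move=> rs [a ar af]; exists a => // N; exact: le_trans (ar N) rs. Qed.

Lemma norm_sum_scale s (a c : mi -> C) N : (forall k, normc (c k) <= s) ->
  norm_sum (fun k => c k * a k) N <= s * norm_sum a N.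
Proof.
move=> cs; rewrite mulr_fsumr; apply: ler_fsumr => [|k _].
  exact: finite_multi_cube.
by rewrite Normc.normcM ler_wpM2r ?normc_ge0 ?cs.
Qed.

Lemma psum_delta c (z : X) N : psum (fun k => c * (k == mi0 d)%:R) z N.+1 = c.
Proof.
rewrite /psum -[RHS]mulr1 -[X in _ = _ * X](@sum_delta d C N) mulr_fsumr.
apply: eq_fsbigr => k _.
case: eqP => [->|_]; first by rewrite monomial0 [LHS]mulr1.
by rewrite mulr0 mul0r.
Qed.

Lemma norm_sum_delta (c : C) N : norm_sum (fun k => c * (k == mi0 d)%:R) N <= normc c.
Proof.
apply: le_trans (norm_sum_homo _ (leqnSn N)) _.
rewrite -[leRHS]mulr1 -[X in _ <= _ * X](@sum_delta d R N) mulr_fsumr.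
apply: ler_fsumr => [|k _]; first exact: finite_multi_cube.
by rewrite Normc.normcM; case: eqP; rewrite ?Normc.normc1 ?Normc.normc0.
Qed.

Lemma wiener_bound_cst c : wiener_bound (normc c) (cst c).
Proof.
exists (fun k => c * (k == mi0 d)%:R) => [N|z]; first exact: norm_sum_delta.
by apply: cvg_near_cst; exists 1%N => // -[//|N] _; rewrite psum_delta.
Qed.

Lemma wiener_boundD r s f g :
  wiener_bound r f -> wiener_bound s g -> wiener_bound (r + s) (f + g).
Proof.
move=> [a ar af] [b bs bg]; exists (fun k => a k + b k) => [N|z].
  apply: le_trans (lerD (ar N) (bs N)).
  rewrite /norm_sum -fsbig_split; last exact: finite_multi_cube.
  apply: ler_fsumr => [|k _]; first exact: finite_multi_cube.
  exact: le_normcD.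
rewrite (_ : (fun N => _) = psum a z \+ psum b z); first exact: cvgD.
apply/funext => N; rewrite [RHS]/= /psum -fsbig_split; last exact: finite_multi_cube.
by apply: eq_fsbigr => k _; rewrite mulrDl.
Qed.

Lemma psum_conv_defect a b r s (z : X) :
  (forall N, norm_sum a N <= r) -> (forall N, norm_sum b N <= s) ->
  psum a z N * psum b z N - psum (mi_conv a b) z N @[N --> \oo] --> (0 : C).
Proof.
move=> ar bs.
rewrite (_ : psum (mi_conv a b) z = fun N => \sum_(k \in cube N)
  mi_conv (fun k => a k * monomial (set_val z) k) (fun k => b k * monomial (set_val z) k) k).
  apply: (@cauchy_defect _ _ _ _ r s) => N.
    exact: le_trans (norm_sum_monomial _ _ _) (ar N).
  exact: le_trans (norm_sum_monomial _ _ _) (bs N).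
by apply/funext => N; apply: eq_fsbigr => k _; rewrite conv_monomial.
Qed.

Lemma wiener_boundM r s f g :
  wiener_bound r f -> wiener_bound s g -> wiener_bound (r * s) (f * g).
Proof.
move=> [a ar af] [b bs bg]; exists (mi_conv a b) => [N|z].
  apply: le_trans (norm_sum_conv _ _ _) _.
  by apply: ler_pM => //; exact: norm_sum_ge0.
rewrite (_ : psum (mi_conv a b) z = fun N => psum a z N * psum b z N -
    (psum a z N * psum b z N - psum (mi_conv a b) z N)); last first.
  by apply/funext => N; rewrite subKr.
rewrite -[(f * g) z]subr0; apply: cvgB; last exact: psum_conv_defect ar bs.
exact: cvgM.
Qed.

(* The coefficients of [(1 - w)^-1] are obtained formally; their absolute
   summability follows from [|b| <= 1 + |w| |b|] on each cube. *)
Lemma wiener_geometric (w : mi -> C) (om : X -> C) : w (mi0 d) = 0 ->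
  (forall N, norm_sum w N <= 2^-1) ->
  (forall z, psum w z N @[N --> \oo] --> om z) ->
  wiener_bound 2 (fun z => (1 - om z)^-1) /\ forall z, 1 - om z != 0.
Proof.
move=> w0 wb wom; have [b bE] := conv_fixpoint w0.
have b2 N : norm_sum b N <= 2.
  have : norm_sum b N <= 1 + 2^-1 * norm_sum b N; last lra.
  apply: (@le_trans _ _ (norm_sum (fun k => 1 * (k == mi0 d)%:R) N + norm_sum (mi_conv w b) N)).
    rewrite /norm_sum -fsbig_split; last exact: finite_multi_cube.
    apply: ler_fsumr => [|k _]; first exact: finite_multi_cube.
    by rewrite {1}bE mul1r; exact: le_normcD.
  apply: lerD; first by rewrite -(Normc.normc1 R); exact: norm_sum_delta.
  apply: le_trans (norm_sum_conv _ _ _) _.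
  by rewrite ler_wpM2r// norm_sum_ge0.
have pw z N : normc (psum w z N) <= 2^-1.
  apply: le_trans (normc_fsum _ (finite_multi_cube _ _)) _.
  exact: le_trans (norm_sum_monomial _ _ _) (wb N).
have pw1 z N : 1 - psum w z N != 0.
  rewrite subr_eq0; apply/eqP => e; have := pw z N; rewrite -e Normc.normc1; lra.
have om1 z : 1 - om z != 0.
  rewrite subr_eq0; apply/eqP => e.
  (* A limit equal to 1 would put a partial sum at distance less than 1/2 from 1, while its modulus
     is at most 1/2. *)
  have /cvgrPdist_lt/(_ (2^-1)%:C%C) := wom z.
  rewrite ltcR invr_gt0 ltr0n => /(_ isT) [N _ /(_ N (leqnn N))].
  rewrite /= -e normc_real ltcR => h.
  have := le_normcD (1 - psum w z N) (psum w z N); rewrite subrK Normc.normc1.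
  by have := pw z N; lra.
split; last exact: om1.
exists b => [N|z]; first exact: b2.
have D0 := psum_conv_defect z wb b2.
rewrite -[(1 - om z)^-1]mul1r -{1}(subr0 (1 : C)).
(* By [b = 1 + w b], the partial sum of [b] equals 1 minus the Cauchy defect, divided by 1 minus the
   partial sum of [w], as soon as the cube contains the index 0. *)
have : (1 - (psum w z N * psum b z N - psum (mi_conv w b) z N)) * (1 - psum w z N)^-1
    @[N --> \oo] --> (1 - 0) * (1 - om z)^-1.
  apply: cvgM; first by apply: cvgB; [exact: cvg_cst|exact: D0].
  apply: (cvgV (om1 z)); apply: cvgB; [exact: cvg_cst|exact: wom].
apply: cvg_trans; apply: near_eq_cvg; exists 1%N; first by [].
case=> [//|N] _; rewrite /=.
apply: (canLR (mulfK (pw1 _ _))).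
have -> : psum b z N.+1 = 1 + psum (mi_conv w b) z N.+1; last by ring.
rewrite -[X in X + _](psum_delta 1 z N) /psum -fsbig_split; last exact: finite_multi_cube.
by apply: eq_fsbigr => k _; rewrite {1}bE mulrDl mul1r.
Qed.

(** The constant 1/3 leaves room for splitting off the constant term [c] of [f]: then [|c| >= 2/3],
    and dividing the remaining terms by [c] leaves norm at most (3/2)(1/3) = 1/2, as the geometric
    series requires. *)
Lemma wiener_bound_inv f : wiener_bound 3^-1 (f - 1) ->
  exists r, wiener_bound r (fun z => (f z)^-1) /\ forall z, f z != 0.
Proof.
move=> [a ar af].
have a0 : normc (a (mi0 d)) <= 3^-1.
  apply: le_trans (ar 1%N); rewrite -(@fsbig_set1 _ _ +%R _ (mi0 d) (fun k => normc (a k))).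
  apply: ler_fsum_subset; [exact: finite_multi_cube| |by move=> *; exact: normc_ge0].
  by move=> _ -> i; rewrite ffunE.
(* [f / c = 1 - w], where [w] has no constant term. *)
pose c := 1 + a (mi0 d).
have c23 : 2 / 3 <= normc c.
  have := le_normcD c (- a (mi0 d)); rewrite addrK normcN Normc.normc1; lra.
have c0 : c != 0 by apply/eqP => c0; move: c23; rewrite c0 Normc.normc0; lra.
pose w k : C := (if k == mi0 d then 0 else - c^-1) * a k.
have ws k : normc (if k == mi0 d then 0 else - c^-1 : C) <= 3 / 2.
  case: ifP => _; first by rewrite Normc.normc0 divr_ge0.
  rewrite normcN Normc.normcV -[3 / 2]invrK lef_pV2 ?posrE ?invr_gt0 ?divr_gt0 ?ltr0n//.
    by rewrite invf_div.
  by apply: lt_le_trans c23; rewrite divr_gt0.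
have wb N : norm_sum w N <= 2^-1.
  apply: le_trans (norm_sum_scale _ _ ws) _; have := ar N; lra.
have wE z N : psum w z N.+1 = - c^-1 * (psum a z N.+1 - a (mi0 d)).
  suff e : psum w z N.+1 + - c^-1 * a (mi0 d) = - c^-1 * psum a z N.+1.
    by rewrite mulrBr -e addrK.
  rewrite -[X in _ + X](psum_delta _ z N) /psum -fsbig_split; last exact: finite_multi_cube.
  rewrite mulr_fsumr; apply: eq_fsbigr => k _; rewrite /w /=.
  by case: eqP => [->|_] /=; ring.
have wom z : psum w z N @[N --> \oo] --> 1 - f z / c.
  have -> : 1 - f z / c = - c^-1 * ((f - 1) z - a (mi0 d)).
    rewrite [(f - 1) z](_ : _ = f z - 1)//; rewrite /c; field; exact: c0.
  have : - c^-1 * (psum a z N - a (mi0 d)) @[N --> \oo] --> - c^-1 * ((f - 1) z - a (mi0 d)).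
    by apply: cvgMr; apply: cvgB; [exact: af|exact: cvg_cst].
  apply: cvg_trans; apply: near_eq_cvg; exists 1%N; first by [].
  by case=> [//|N] _; rewrite wE.
have w0 : w (mi0 d) = 0 by rewrite /w eqxx mul0r.
have [gb g0] := wiener_geometric w0 wb wom.
exists (normc c^-1 * 2); split; last first.
  by move=> z; apply/eqP => fz; have := g0 z; rewrite fz mul0r subr0 subrr eqxx.
rewrite (_ : (fun z => _) = cst c^-1 * (fun z => (1 - (1 - f z / c))^-1)).
  by apply: wiener_boundM gb; exact: wiener_bound_cst.
apply/funext => z; rewrite [RHS](_ : _ = c^-1 * (1 - (1 - f z / c))^-1)//.
by rewrite subKr invf_div; apply/esym/mulKf.
Qed.

Lemma normc_Re (x : R) : 0 <= x -> normc x%:C%C = x.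
Proof. by move=> x0; rewrite /= expr0n addr0 sqrtr_sqr ger0_norm. Qed.

Lemma psum_dilation a t z N :
  psum a (dilation (@closed_polydisc_star R d) t z) N =
  psum (fun k => (clamp t)%:C%C ^+ mi_deg k * a k) z N.
Proof.
by apply: eq_fsbigr => k _; rewrite dilationE monomialZ mulrCA mulrA.
Qed.

Lemma wiener_bound_dilation r f t : wiener_bound r f ->
  wiener_bound r (f \o dilation (@closed_polydisc_star R d) t).
Proof.
move=> [a ar af]; exists (fun k => (clamp t)%:C%C ^+ mi_deg k * a k) => [N|z].
  rewrite -[r]mul1r; apply: le_trans (norm_sum_scale _ _ _) (ler_wpM2l ler01 (ar N)) => k.
  have /andP[t0 t1] := clamp_itv t.
  by rewrite -rmorphXn normc_Re ?exprn_ge0// exprn_ile1.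
rewrite (_ : psum _ z = psum a (dilation (@closed_polydisc_star R d) t z)); first exact: af.
by apply/funext => N; rewrite psum_dilation.
Qed.

Lemma exprB_le (s t : R) n : 0 <= s <= 1 -> 0 <= t <= 1 ->
  `|s ^+ n - t ^+ n| <= n%:R * `|s - t|.
Proof.
move=> /andP[s0 s1] /andP[t0 t1]; rewrite subrXX normrM mulrC ler_wpM2r//.
apply: le_trans (ler_norm_sum _ _ _) _; rewrite -[n in leRHS]card_ord -sumr_const.
apply: ler_sum => i _; rewrite ger0_norm ?mulr_ge0 ?exprn_ge0//.
by rewrite mulr_ile1 ?exprn_ge0 ?exprn_ile1.
Qed.

Lemma exprB_le1 (s t : R) n : 0 <= s <= 1 -> 0 <= t <= 1 ->
  `|s ^+ n - t ^+ n| <= 1.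
Proof.
move=> /andP[s0 s1] /andP[t0 t1].
have := exprn_ge0 n s0; have := exprn_ge0 n t0.
have := exprn_ile1 n s0 s1; have := exprn_ile1 n t0 t1.
by rewrite ler_norml; lra.
Qed.

(** The difference has coefficients [(s^m - t^m) a_k] with m the degree of [k] and the parameters
    clamped. In a large cube of side [N0] the factor is at most [d * N0 * |s - t|]; outside it the
    factor is at most 1 and the coefficients left over have total modulus at most [e / 2]. *)
Lemma wiener_bound_unif r f e : wiener_bound r f -> 0 < e ->
  \forall h \near 0^'+, forall s t, `|s - t| <= h ->
    wiener_bound e ((f \o dilation (@closed_polydisc_star R d) s) -
                    (f \o dilation (@closed_polydisc_star R d) t)).
Proof.
move=> [a ar af] e0.
have [N0 aN0] : exists N0, forall N, norm_sum a N - norm_sum a N0 <= e / 2.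
  have e20 : 0 < e / 2 by rewrite divr_gt0.
  have ca := norm_sum_cvg ar.
  have /cvgrPdist_lt/(_ _ e20)[N0 _ hN0] := ca.
  exists N0 => N; have /= := hN0 N0 (leqnn _).
  have := nondecreasing_cvgn_le (@norm_sum_homo d R a) ca N.
  by rewrite ltr_norml => aN /andP[_]; lra.
pose D : R := (d * N0)%:R.
have r0 : 0 <= r := le_trans (norm_sum_ge0 a 0) (ar 0%N).
(* This makes [D * h * r] at most [e / 2]; the 1 keeps the denominator positive when [D * r = 0]. *)
have : \forall h \near (0 : R)^'+, h < e / 2 / (D * r + 1).
  by apply: nbhs_right_lt; rewrite !divr_gt0// ltr_wpDl// mulr_ge0.
apply: filterS => h hh s t st.
pose g (k : mi) : C := (clamp s)%:C%C ^+ mi_deg k - (clamp t)%:C%C ^+ mi_deg k.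
exists (fun k => g k * a k) => [N|z]; last first.
  rewrite (_ : psum _ z = fun N =>
    psum a (dilation (@closed_polydisc_star R d) s z) N -
    psum a (dilation (@closed_polydisc_star R d) t z) N); first by apply: cvgB; exact: af.
  apply/funext => N; rewrite !psum_dilation; apply/esym/(canLR (addrK _)).
  rewrite /psum -fsbig_split; last exact: finite_multi_cube.
  by apply: eq_fsbigr => k _; rewrite /g /=; ring.
have h0 : 0 <= h by apply: le_trans st; exact: normr_ge0.
have gE k : normc (g k) = `|clamp s ^+ mi_deg k - clamp t ^+ mi_deg k|.
  by rewrite /g -!rmorphXn -rmorphB /= expr0n addr0 sqrtr_sqr.
pose M := maxn N N0.
apply: le_trans (norm_sum_homo _ (leq_maxl N N0)) _; rewrite -/M.
have cubeM : cube M `&` cube N0 = cube N0.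
  by rewrite setIC; apply/setIidl/multi_cube_sub; exact: leq_maxr.
have fM : finite_set (cube M) by exact: finite_multi_cube.
rewrite /norm_sum (fsbigID (cube N0) (cube M))//= cubeM.
have near_part : \sum_(k \in cube N0) normc (g k * a k) <= D * h * r.
  apply: (@le_trans _ _ (D * h * norm_sum a N0)); last first.
    by rewrite ler_wpM2l// mulr_ge0.
  rewrite mulr_fsumr; apply: ler_fsumr => [|k kN]; first exact: finite_multi_cube.
  rewrite Normc.normcM ler_wpM2r ?normc_ge0// gE.
  apply: le_trans (exprB_le _ (clamp_itv s) (clamp_itv t)) _.
  apply: ler_pM => //; first by rewrite ler_nat mi_deg_cube.
  exact: le_trans (clamp_dist s t) st.
have far_part : \sum_(k \in cube M `&` ~` cube N0) normc (g k * a k) <= e / 2.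
  apply: le_trans (aN0 M); rewrite lerBrDl /norm_sum [leRHS](fsbigID (cube N0) (cube M))//=.
  rewrite cubeM lerD2l; apply: ler_fsumr => [|k _].
    by apply: sub_finite_set fM; exact: subIsetl.
  by rewrite Normc.normcM ler_piMl ?normc_ge0// gE exprB_le1// clamp_itv.
apply: le_trans (lerD near_part far_part) _.
move: hh; rewrite ltr_pdivlMr ?ltr_wpDl ?mulr_ge0// mulrDr mulr1.
by rewrite -[D * h * r]mulrA [h * r]mulrC mulrA [_ * h]mulrC; lra.
Qed.

Lemma special_linear_wiener n :
  special_linear (wiener_algebra R d) n = elementary_group (wiener_algebra R d) n.
Proof.
have vb (a : wiener_algebra R d) : exists r, wiener_bound r (val a).
  by apply/wiener_boundP; exact: valP.
have bv f r : wiener_bound r f -> exists a : wiener_algebra R d, val a = f.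
  move=> fr; have fP : f \in @abs_power_series R d by apply/wiener_boundP; exists r.
  by exists (WienerAlgebra fP).
apply: (@special_linear_contraction R _ _ val val_inj wiener_bound _ _ _ _ _
  (dilation (@closed_polydisc_star R d)) (SigSub (mem_set (@closed_polydisc0 R d)))).
- exact: wiener_bound_le.
- by rewrite -(Normc.normc0 R); exact: wiener_bound_cst.
- exact: wiener_boundD.
- exact: wiener_boundM.
- move=> a /wiener_bound_inv[r [/bv[b vbE] a0]]; exists b.
  apply/funext => z; apply: etrans (divff (a0 z)).
  exact: (congr1 (fun g => val a z * g z) vbE).
- exact: dilation1.
- exact: dilation0.
- by move=> k; exact: bv (wiener_bound_cst k).
- by move=> a t; have [r ar] := vb a; exact: bv (wiener_bound_dilation t ar).
- by move=> a; have [r ar] := vb a; exists r => t; exact: wiener_bound_dilation.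
- by move=> a e e0; have [r ar] := vb a; exact: wiener_bound_unif ar e0.
Qed.

End Wiener.

Theorem theorem1p4 (R : realType) (d n : nat) (hd : (1 <= d)%N)
    (hn : (1 <= n)%N) :
  [/\ special_linear (polydisc_algebra R d) n =
        elementary_group (polydisc_algebra R d) n,
      special_linear (ball_algebra R d) n =
        elementary_group (ball_algebra R d) n
    & special_linear (wiener_algebra R d) n =
        elementary_group (wiener_algebra R d) n].
Proof.
split; [exact: special_linear_polydisc|exact: special_linear_ball|].
exact: special_linear_wiener.
Qed.
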